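(* Let $\mathcal{P}$ be a family of finite subsets of $\mathbb{N}=\{1,2,3,\dots\}$ (called admissible sets) with $\emptyset\in\mathcal{P}$, satisfying: (1) (downward closed) if $B\in\mathcal{P}$ and $B'\subseteq B$, then $B'\in\mathcal{P}$; (2) (decomposes over coprime components) if $T=T_1\sqcup T_2$ is finite and there is no divisibility relation between an element of $T_1$ and an element of $T_2$, then for every $B\subseteq T$ we have $B\in\mathcal{P}$ if and only if $B\cap T_1\in\mathcal{P}$ and $B\cap T_2\in\mathcal{P}$; (3) (preserved by integer dilation) if $m\in\mathbb{N}$ and $B$ is finite, then $B\in\mathcal{P}$ if and only if $mB\in\mathcal{P}$, where $mB:=\{mb: b\in B\}$. Write $f_{\mathcal{P}}(n):=\Phi_{\mathcal{P}}(\{1,\dots,n\})$, $q_{\mathcal{P}}(n):=Q_{\mathcal{P}}(\{1,\dots,n\})$, $c_{\mathcal{P}}:=C_{\Phi_{\mathcal{P}}}$ and $\beta_{\mathcal{P}}:=\exp(C_{\log Q_{\mathcal{P}}})$ (the defining series converge absolutely). Then for every $\varepsilon>0$: (a) $f_{\mathcal{P}}(n)=c_{\mathcal{P}}\,n+O_{\varepsilon}\!\left(n\exp\!\bigl(-(1-\varepsilon)\sqrt{\log n\,\log\log n}\bigr)\right)$; (b) $\log q_{\mathcal{P}}(n)=n\log\beta_{\mathcal{P}}+O_{\varepsilon}\!\left(n\exp\!\bigl(-(1-\varepsilon)\sqrt{\log n\,\log\log n}\bigr)\right)$; in particular $\lim_{n\to\infty}q_{\mathcal{P}}(n)^{1/n}=\beta_{\mathcal{P}}$.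 If in addition membership in $\mathcal{P}$ is decidable for finite sets, then $c_{\mathcal{P}}$ and $\beta_{\mathcal{P}}$ are effectively computable.
   Context: For a family $\mathcal{P}$ of finite subsets of $\mathbb{N}$ and a finite set $T\subset\mathbb{N}$, define $\Phi_{\mathcal{P}}(T):=\max\{|B|: B\subseteq T,\ B\in\mathcal{P}\}$ and $Q_{\mathcal{P}}(T):=\#\{B\subseteq T: B\in\mathcal{P}\}$. Let $P^+(d)$ denote the largest prime factor of $d$, with $P^+(1)=1$. For a function $\Psi$ on finite subsets of $\mathbb{N}$, define (when the series converges absolutely) $$C_{\Psi}:=\sum_{i=1}^{\infty}\left(\prod_{p\le i}\frac{p-1}{p}\right)\sum_{\substack{d\ge1\\ P^+(d)\le i}}\ \sum_{t\in[id,(i+1)d)}\frac{\Psi(\{d,\dots,t\})-\Psi(\{d+1,\dots,t\})}{t(t+1)},$$ where $p$ ranges over primes, $t$ over integers, and $\{a,\dots,b\}$ denotes the integer interval. $\log Q_{\mathcal{P}}$ denotes the function $T\mapsto\log Q_{\mathcal{P}}(T)$. The notation $X(n)=Y(n)+O_\varepsilon(Z(n))$ means there is a constant $K_\varepsilon$ depending only on $\varepsilon$ (and $\mathcal{P}$) with $|X(n)-Y(n)|\le K_\varepsilon Z(n)$ for all sufficiently large $n$. *)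

(* Defs.v *)
From HB Require Import structures.
From mathcomp Require Import all_boot all_order all_algebra.
From mathcomp Require Import finmap.
From mathcomp Require Import all_classical all_reals all_analysis.

Set Implicit Arguments.
Unset Strict Implicit.
Unset Printing Implicit Defensive.

Import Order.TTheory GRing.Theory Num.Theory.
Import numFieldNormedType.Exports.

Local Open Scope classical_set_scope.
Local Open Scope fset_scope.
Local Open Scope ring_scope.

(* The paper's N is {1, 2, 3, ...}: a finite set of positive integers is
   a B : {fset nat} such that 0%N \notin B. *)
Definition on_positive (P : set {fset nat}) : Prop :=
  forall B : {fset nat}, P B -> 0%N \notin B.

Definition downward_closed (P : set {fset nat}) : Prop :=
  forall B B' : {fset nat}, P B -> (B' `<=` B)%fset -> P B'.

Definition decomposes (P : set {fset nat}) : Prop :=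
  forall T1 T2 : {fset nat},
    0%N \notin T1 -> 0%N \notin T2 ->
    [disjoint T1 & T2]%fset ->
    (forall a b : nat, a \in T1 -> b \in T2 -> ~~ (a %| b)%N /\ ~~ (b %| a)%N) ->
    forall B : {fset nat}, (B `<=` T1 `|` T2)%fset ->
      (P B <-> P (B `&` T1)%fset /\ P (B `&` T2)%fset).

Definition dilation_invariant (P : set {fset nat}) : Prop :=
  forall (m : nat) (B : {fset nat}), (0 < m)%N -> 0%N \notin B ->
    (P B <-> P [fset (m * b)%N | b in B]%fset).

Definition nat_interval (a b : nat) : {fset nat} :=
  [fset k in index_iota a b.+1]%fset.

Definition Phi (P : set {fset nat}) (T : {fset nat}) : nat :=
  (\max_(B <- fpowerset T | B \in P) #|` B|)%N.

Definition Q (P : set {fset nat}) (T : {fset nat}) : nat :=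
  #|` [fset B in fpowerset T | B \in P]%fset|.

Definition f_ (P : set {fset nat}) (n : nat) : nat := Phi P (nat_interval 1 n).

Definition q_ (P : set {fset nat}) (n : nat) : nat := Q P (nat_interval 1 n).

Section Constants.
Variable R : realType.

Definition PhiR (P : set {fset nat}) (T : {fset nat}) : R := (Phi P T)%:R.

Definition logQ (P : set {fset nat}) (T : {fset nat}) : R := ln (Q P T)%:R.

Definition euler_factor (i : nat) : R :=
  \prod_(1 <= p < i.+1 | prime p) ((p%:R - 1) / p%:R).

Definition C_term (Psi : {fset nat} -> R) (d t : nat) : R :=
  (Psi (nat_interval d t) - Psi (nat_interval d.+1 t)) / (t * t.+1)%N%:R.

(* max_pdiv d is P^+(d), with max_pdiv 1 = 1.  The infinite sums are limits of
   partial sums, hence meaningful under C_abs_cvg below. *)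
Definition C_ (Psi : {fset nat} -> R) : R :=
  \big[+%R/0]_(1 <= i <oo)
    (euler_factor i *
     \big[+%R/0]_(1 <= d <oo | (max_pdiv d <= i)%N)
       \sum_((i * d)%N <= t < (i.+1 * d)%N) C_term Psi d t).

(* The same triple series for the absolute values of its terms, as an extended
   real, is finite. *)
Definition C_abs_cvg (Psi : {fset nat} -> R) : Prop :=
  (\sum_(1 <= i <oo)
     ((euler_factor i)%:E *
      \sum_(1 <= d <oo | (max_pdiv d <= i)%N)
        (\sum_((i * d)%N <= t < (i.+1 * d)%N) `|C_term Psi d t|)%:E) < +oo)%E.

Definition c_ (P : set {fset nat}) : R := C_ (PhiR P).

Definition beta_ (P : set {fset nat}) : R := expR (C_ (logQ P)).

Definition error_term (eps : R) (n : nat) : R :=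
  n%:R * expR (- (1 - eps) * Num.sqrt (ln n%:R * ln (ln n%:R))).

End Constants.

(* Kleene's total recursive functions: minimization is only applied to g when
   it has a zero above every v, f v being the least one. *)
Inductive recursive : forall k : nat, (k.-tuple nat -> nat) -> Prop :=
| rec_zero (k : nat) : recursive (fun _ : k.-tuple nat => 0%N)
| rec_succ : recursive (fun v : 1.-tuple nat => (thead v).+1)
| rec_proj (k : nat) (i : 'I_k) :
    recursive (fun v : k.-tuple nat => tnth v i)
| rec_comp (k m : nat) (g : m.-tuple nat -> nat)
    (h : 'I_m -> k.-tuple nat -> nat) :
    recursive g -> (forall i, recursive (h i)) ->
    recursive (fun v : k.-tuple nat => g [tuple h i v | i < m])
| rec_prim (k : nat) (g : k.-tuple nat -> nat) (h : k.+2.-tuple nat -> nat) :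
    recursive g -> recursive h ->
    recursive (fun v : k.+1.-tuple nat =>
      let w : k.-tuple nat := [tuple of behead v] in
      iteri (thead v) (fun j r => h [tuple of j :: r :: w]) (g w))
| rec_min (k : nat) (g : k.+1.-tuple nat -> nat) (f : k.-tuple nat -> nat) :
    recursive g ->
    (forall v : k.-tuple nat, g [tuple of f v :: v] = 0%N /\
       forall j : nat, (j < f v)%N -> g [tuple of j :: v] <> 0%N) ->
    recursive f.

Definition recursive1 (f : nat -> nat) : Prop :=
  recursive (fun v : 1.-tuple nat => f (thead v)).

(* Canonical index of a finite set of naturals. *)
Definition fset_code (B : {fset nat}) : nat := (\sum_(b <- B) 2 ^ b)%N.

Definition decidable_family (P : set {fset nat}) : Prop :=
  exists chi : nat -> nat, recursive1 chi /\
    forall B : {fset nat}, 0%N \notin B ->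
      chi (fset_code B) = (B \in P : nat).

(* x is the limit of a computable sequence of rationals (sign, numerator,
   denominator) with known rate of convergence 2^-k. *)
Definition computable_real (R : realType) (x : R) : Prop :=
  exists s a b : nat -> nat,
    [/\ recursive1 s, recursive1 a, recursive1 b,
        forall k : nat, b k <> 0%N &
        forall k : nat,
          `|x - (-1) ^+ s k * (a k)%:R / (b k)%:R| <= 2%:R ^- k].

(* Main.v *)
(* Put g(m, n) = Psi [m, n] - Psi [m + 1, n], so that Psi [1, n] = sum_m g(m, n).
   Write i = floor (n / m) and m = d k with d i-smooth and k free of primes <= i.
   Two elements of [m, n] in a divisibility relation have a quotient <= i, so the
   elements k e with e i-smooth form a component, and dilation by k gives
   g(m, n) = g(d, floor (n / k)).  Hence Psi [1, n] is the sum over i, over i-smooth d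
   and over t in [i d, (i + 1) d) of g(d, t) times the number of i-rough k in
   (n / (t + 1), n / t], and a sieve replaces this number by its density, which
   gives n C_Psi.
   For the error, indices i > exp (sqrt (ln n ln ln n)) are trivial; for the others,
   d > n ^ (1/2 - eta) is handled by Rankin's trick and d <= n ^ (1/2 - eta) by
   Brun's sieve combined with Rankin's trick.  With u = ln n / ln i, both give
   (n / i) u ^ (- u / 2) for each dyadic range of i up to lower order factors, largest
   for i = exp (sqrt (ln n ln ln n) / 2).
   The same rate of convergence, with constants that need not be computed, makes
   f(n) / n and q(n) ^ (1 / n) along n = 2 ^ (k ^ 2) computable approximations of
   c and beta. *)

(* [Phi] and log [Q] enter only through additivity over sets without mutual divisibility, dilation
   invariance, and increments of absolute value at most 1. Once the increments are localized, the
   estimates use |g| <= 1 alone. The obstacle is the sieve error. For given i and d it is summed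
   over d values of t, hence is about d Z ^ r with Z > i, and must stay below the main term, of size
   n / (i ^ 2 d). This forces d ^ 2 < n and the cut at n ^ (1/2 - eta); beyond the cut only the
   rarity of smooth numbers helps. Both regimes share one parameter v: the Rankin exponent is v / ln
   Z, and the sieve remainder S ^ r / r!, where S bounds the sum of 1 / p, is to be at most exp (- r
   v). The latter needs r >= e S exp v, while r has order ln n / ln Z and ln Z may be as large as
   sqrt (ln n ln ln n). So exp v = (ln n) ^ (1/2 - eta) is essentially the largest choice; on the
   logarithmic scale it is comparable with u for the critical i. *)
Require Import Defs.
From HB Require Import structures.
From mathcomp Require Import all_boot all_order all_algebra.
From mathcomp Require Import finmap.
From mathcomp Require Import all_classical all_reals all_analysis.
From mathcomp Require Import zify ring lra.

Set Implicit Arguments.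
Unset Strict Implicit.
Unset Printing Implicit Defensive.

Import Order.TTheory GRing.Theory Num.Theory.
Import numFieldNormedType.Exports.

Local Open Scope ring_scope.

(** * Phi and Q for admissible families *)

Section Admissible.
Local Open Scope fset_scope.
Variables (P : set {fset nat}).
Hypotheses (P_empty : P fset0)
  (P_down : downward_closed P) (P_decomp : decomposes P)
  (P_dil : dilation_invariant P).

Lemma Phi_ge (T B : {fset nat}) : B `<=` T -> P B -> (#|` B| <= Phi P T)%N.
Proof.
move=> BT PB; rewrite /Phi.
apply: (@leq_bigmax_seq _ _ _ (fun B : {fset nat} => #|` B|)).
  by have := BT; rewrite -fpowersetE.
by rewrite inE.
Qed.

Lemma Phi_attained (T : {fset nat}) :
  exists B : {fset nat}, [/\ B `<=` T, P B & #|` B| = Phi P T].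
Proof.
rewrite /Phi big_seq_cond.
elim/big_ind: _ => [|x y [B [BT PB <-]] [C [CT PC <-]]|B /andP[BT PB]].
- by exists fset0; rewrite fsub0set cardfs0.
- by case: (leqP #|` B| #|` C|) => h;
    [exists C | exists B]; split => //; lia.
- exists B; split => //; first by rewrite -fpowersetE.
  by move: PB; rewrite inE.
Qed.

Lemma Q_gt0 (T : {fset nat}) : (0 < Q P T)%N.
Proof.
rewrite /Q cardfs_gt0; apply/fset0Pn; exists fset0.
by rewrite !inE /= fpowersetE fsub0set inE.
Qed.

Definition adm (T : {fset nat}) : {fset {fset nat}} :=
  [fset B in fpowerset T | B \in P].

Lemma admP (T B : {fset nat}) : reflect (B `<=` T /\ P B) (B \in adm T).
Proof.
apply: (iffP idP); rewrite !inE /= fpowersetE.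
  by move=> /andP[-> PB]; split => //; apply/set_mem.
by move=> [-> PB]; apply/mem_set.
Qed.

Lemma card_fsetM (A B : {fset {fset nat}}) :
  #|` A `*` B| = (#|` A| * #|` B|)%N.
Proof.
rewrite -(size_allpairs pair A B); apply/perm_size/uniq_perm => //.
  by apply: allpairs_uniq => // -[x1 y1] [x2 y2].
move=> [x y]; rewrite in_fsetM.
by apply/andP/allpairsP => /= [[xA yB]|[[x' y'] [xA yB [-> ->]]]]; first exists (x, y).
Qed.

Lemma fsetIU_disjoint (A B T : {fset nat}) :
  A `<=` T -> [disjoint B & T] -> (A `|` B) `&` T = A.
Proof. by move=> AT /eqP BT; rewrite fsetIUl (fsetIidPl AT) BT fsetU0. Qed.

Section Components.
Variables T1 T2 : {fset nat}.
Hypotheses (T1_pos : 0%N \notin T1) (T2_pos : 0%N \notin T2)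
  (disj : [disjoint T1 & T2])
  (indep : forall a b : nat, a \in T1 -> b \in T2 ->
     ~~ (a %| b)%N /\ ~~ (b %| a)%N).

Lemma fsubset_disjoint (B1 B2 : {fset nat}) :
  B1 `<=` T1 -> B2 `<=` T2 -> [disjoint B2 & T1] * [disjoint B1 & T2].
Proof.
move=> B1T B2T; split; first by rewrite fdisjoint_sym; apply: fdisjointWr B2T disj.
exact: fdisjointWl B1T disj.
Qed.

Lemma P_fsetU (B1 B2 : {fset nat}) : B1 `<=` T1 -> B2 `<=` T2 ->
  P (B1 `|` B2) <-> P B1 /\ P B2.
Proof.
move=> B1T B2T.
have := P_decomp T1_pos T2_pos disj indep (fsetUSS B1T B2T).
have [d1 d2] := fsubset_disjoint B1T B2T.
by rewrite fsetIU_disjoint // fsetUC fsetIU_disjoint.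
Qed.

Lemma PhiU : Phi P (T1 `|` T2) = (Phi P T1 + Phi P T2)%N.
Proof.
apply/eqP; rewrite eqn_leq; apply/andP; split.
  have [B [BT PB <-]] := Phi_attained (T1 `|` T2).
  have := P_decomp T1_pos T2_pos disj indep BT => -[/(_ PB)[P1 P2] _].
  have -> : B = (B `&` T1) `|` (B `&` T2) by rewrite -fsetIUr (fsetIidPl BT).
  apply: (leq_trans (leq_card_fsetU _ _).1).
  by apply: leq_add; apply: Phi_ge => //; apply: fsubsetIr.
have [B1 [BT1 PB1 <-]] := Phi_attained T1.
have [B2 [BT2 PB2 <-]] := Phi_attained T2.
rewrite -(_ : #|` B1 `|` B2| = #|` B1| + #|` B2|)%N; last first.
  apply/eqP; rewrite (leq_card_fsetU _ _).2.
  by apply: fdisjointWl BT1 _; apply: fdisjointWr BT2 _.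
by apply: Phi_ge; [apply: fsetUSS | apply/P_fsetU].
Qed.

(** Taking unions is a bijection from pairs of admissible subsets of T1 and T2 to the admissible
    subsets of the union; intersecting with T1 and T2 inverts it. *)
Lemma QU : Q P (T1 `|` T2) = (Q P T1 * Q P T2)%N.
Proof.
pose join (B : {fset nat} * {fset nat}) := B.1 `|` B.2.
have -> : Q P (T1 `|` T2) = #|` [fset join B | B in adm T1 `*` adm T2]|.
  congr (size (enum_fset _)); apply/fsetP => B.
  apply/idP/imfsetP => /= [|[[B1 B2]]].
    move=> /admP[BT PB].
    exists (B `&` T1, B `&` T2); last by rewrite /join /= -fsetIUr (fsetIidPl BT).
    have [/(_ PB)[P1 P2] _] := P_decomp T1_pos T2_pos disj indep BT.
    by rewrite in_fsetM; apply/andP; split; apply/admP; split => //; apply: fsubsetIr.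
  rewrite in_fsetM => /andP[/admP[B1T P1] /admP[B2T P2]] ->.
  by apply/admP; split; [apply: fsetUSS | apply/P_fsetU].
rewrite card_in_imfset /=; first exact: card_fsetM.
move=> [B1 B2] [C1 C2]; rewrite !in_fsetM.
move=> /andP[/admP[/= B1T _] /admP[/= B2T _]] /andP[/admP[/= C1T _] /admP[/= C2T _]].
rewrite /join /= => e.
have [d1 d2] := fsubset_disjoint B1T B2T; have [e1 e2] := fsubset_disjoint C1T C2T.
congr pair.
  by rewrite -(fsetIU_disjoint B1T d1) e fsetIU_disjoint.
by rewrite -(fsetIU_disjoint B2T d2) fsetUC e fsetUC fsetIU_disjoint.
Qed.

End Components.

Definition dilate (m : nat) (B : {fset nat}) : {fset nat} :=
  [fset (m * b)%N | b in B].

Lemma fsub_dilate (m : nat) (B T : {fset nat}) : B `<=` dilate m T ->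
  exists2 C : {fset nat}, C `<=` T & B = dilate m C.
Proof.
move=> BT; exists [fset x in T | (m * x)%N \in B].
  by apply/fsubsetP => x; rewrite !inE => /andP[].
apply/fsetP => x; apply/idP/imfsetP => /= [xB|[y]]; last first.
  by rewrite !inE => /andP[_ yB] ->.
have /imfsetP[y /= yT e] := fsubsetP BT _ xB.
by exists y => //; rewrite !inE yT -e.
Qed.

Lemma dilate_inj m : (0 < m)%N -> injective (dilate m).
Proof.
move=> m0; apply: can_inj (fun B => [fset (x %/ m)%N | x in B]) _ => B.
apply/fsetP => x; apply/imfsetP/idP => /= [[y /imfsetP[z /= zB ->] ->]|xB].
  by rewrite mulKn.
by exists (m * x)%N; rewrite ?mulKn //; apply/imfsetP; exists x.
Qed.

Lemma card_dilate m B : (0 < m)%N -> #|` dilate m B| = #|` B|.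
Proof.
move=> m0; rewrite card_imfset //= => x y /eqP.
by rewrite eqn_mul2l eqn0Ngt m0 => /eqP.
Qed.

Lemma notin0_sub (B T : {fset nat}) : B `<=` T -> 0%N \notin T -> 0%N \notin B.
Proof. by move=> BT; apply: contra => /(fsubsetP BT). Qed.

Lemma P_dilate m (B T : {fset nat}) : (0 < m)%N -> 0%N \notin T -> B `<=` T ->
  P B <-> P (dilate m B).
Proof. by move=> m0 T0 BT; apply: P_dil (notin0_sub BT T0). Qed.

Lemma dilateS m (B T : {fset nat}) : B `<=` T -> dilate m B `<=` dilate m T.
Proof.
move=> BT; apply/fsubsetP => x /imfsetP[y /= yB ->].
by apply/imfsetP; exists y => //; exact: (fsubsetP BT).
Qed.

Lemma Phi_dilate m (T : {fset nat}) :
  (0 < m)%N -> 0%N \notin T -> Phi P (dilate m T) = Phi P T.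
Proof.
move=> m0 T0; apply/eqP; rewrite eqn_leq; apply/andP; split.
  have [B [/fsub_dilate[C CT ->] PB <-]] := Phi_attained (dilate m T).
  rewrite card_dilate //; apply: Phi_ge => //.
  exact/(P_dilate m0 T0 CT).
have [B [BT PB <-]] := Phi_attained T.
rewrite -(card_dilate B m0); apply: Phi_ge; first exact: dilateS.
exact/(P_dilate m0 T0 BT).
Qed.

Lemma Q_dilate m (T : {fset nat}) :
  (0 < m)%N -> 0%N \notin T -> Q P (dilate m T) = Q P T.
Proof.
move=> m0 T0.
have -> : Q P (dilate m T) = #|` [fset dilate m B | B in adm T]|.
  congr (size (enum_fset _)); apply/fsetP => B.
  apply/idP/imfsetP => /= [|[C]].
    move=> /admP[/fsub_dilate[C CT ->] PB]; exists C => //.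
    by apply/admP; split => //; apply/(P_dilate m0 T0 CT).
  move=> /admP[CT PC] ->; apply/admP; split; first exact: dilateS.
  exact/(P_dilate m0 T0 CT).
by rewrite card_imfset //=; apply: dilate_inj.
Qed.

Lemma Phi_fsetU1 x T : (Phi P T <= Phi P (x |` T) <= (Phi P T).+1)%N.
Proof.
apply/andP; split.
  have [B [BT PB <-]] := Phi_attained T; apply: Phi_ge => //.
  exact: fsubset_trans BT (fsubsetUr _ _).
have [B [BT PB <-]] := Phi_attained (x |` T).
have : (#|` B `\ x| <= Phi P T)%N.
  apply: Phi_ge; last by apply: P_down PB _; apply: fsubsetDl.
  by rewrite fsubDset.
by rewrite (cardfsD1 x B); case: (x \in B) => /=; lia.
Qed.

Lemma Q_fsetU1 x T : (Q P T <= Q P (x |` T) <= 2 * Q P T)%N.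
Proof.
apply/andP; split.
  apply: fsubset_leq_card; apply/fsubsetP => B /admP[BT PB].
  by apply/admP; split => //; apply: fsubset_trans BT (fsubsetUr _ _).
rewrite mul2n -addnn.
apply: (@leq_trans #|` adm T `|` [fset x |` B | B in adm T]|); last first.
  apply: (leq_trans (leq_card_fsetU _ _).1); rewrite leq_add2l.
  exact: leq_imfset_card.
apply: fsubset_leq_card; apply/fsubsetP => B /admP[BT PB].
have BD : B `\ x \in adm T.
  apply/admP; split; first by rewrite fsubDset.
  by apply: P_down PB _; apply: fsubsetDl.
rewrite in_fsetU; apply/orP.
case: (boolP (x \in B)) => xB; [right|left].
  by apply/imfsetP; exists (B `\ x) => //=; rewrite fsetD1K.
suff <- : B `\ x = B by [].
by apply/fsetP => y; rewrite !inE; case: eqP => // ->; rewrite (negPf xB).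
Qed.

End Admissible.

(** * Set functions additive with respect to divisibility *)

Section Additive.
Local Open Scope fset_scope.
Variable R : realType.

(** The common abstraction of [PhiR] and [logQ], so that the asymptotics are proved once for
    both. *)
Record divisor_additive (Psi : {fset nat} -> R) : Prop := DivisorAdditive {
  dadd_U : forall T1 T2 : {fset nat}, 0%N \notin T1 -> 0%N \notin T2 ->
    [disjoint T1 & T2] ->
    (forall a b : nat, a \in T1 -> b \in T2 -> ~~ (a %| b)%N /\ ~~ (b %| a)%N) ->
    Psi (T1 `|` T2) = (Psi T1 + Psi T2)%R;
  dadd_dilate : forall (m : nat) (T : {fset nat}), (0 < m)%N -> 0%N \notin T ->
    Psi (dilate m T) = Psi T;
  dadd_U1 : forall (x : nat) (T : {fset nat}), (`|Psi (x |` T)%fset - Psi T| <= 1)%R }.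

Variables (P : set {fset nat}).
Hypotheses (P_empty : P fset0)
  (P_down : downward_closed P) (P_decomp : decomposes P)
  (P_dil : dilation_invariant P).

Lemma divisor_additive_Phi : divisor_additive (@PhiR R P).
Proof.
split => [T1 T2 T10 T20 d i|m T m0 T0|x T]; rewrite /PhiR.
- by rewrite PhiU // natrD.
- by rewrite Phi_dilate.
- have /andP[h1 h2] := Phi_fsetU1 P_empty P_down x T.
  rewrite ger0_norm ?subr_ge0 ?ler_nat // lerBlDl.
  by rewrite -[1]/(1%:R) -natrD addn1 ler_nat.
Qed.

Lemma divisor_additive_logQ : divisor_additive (@logQ R P).
Proof.
have Qp T : (Q P T)%:R \is @Num.pos R by rewrite posrE ltr0n Q_gt0.
split => [T1 T2 T10 T20 d i|m T m0 T0|x T]; rewrite /logQ.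
- by rewrite QU // natrM lnM.
- by rewrite Q_dilate.
- have /andP[h1 h2] := Q_fsetU1 P_down x T.
  rewrite ger0_norm ?subr_ge0 ?ler_ln ?ler_nat // -ln_div //.
  apply: (@le_trans _ _ (ln 2%:R)); last first.
    rewrite -[leRHS](@expRK R 1) ler_ln ?posrE ?expR_gt0 ?ltr0n //.
    by apply: le_trans (expR_ge1Dx 1).
  rewrite ler_ln ?posrE ?divr_gt0 ?ltr0n ?Q_gt0 //.
  by rewrite ler_pdivrMr ?ltr0n ?Q_gt0 // -natrM ler_nat.
Qed.

End Additive.

(** * Localization of the increments *)

(** The factorization m = d k into an i-smooth and an i-rough factor is that into pi-parts, for pi
    the set of primes at most i. *)
Definition upto (i : nat) : nat_pred := [pred p : nat | (p <= i)%N].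
Definition rough_part (i m : nat) : nat := (m`_((upto i)^'))%N.
Definition smooth_part (i m : nat) : nat := (m`_(upto i))%N.

Section Parts.
Local Open Scope nat_scope.

Lemma leq_upto i j : i <= j -> {subset upto i <= upto j}.
Proof. by move=> ij p; rewrite !inE => /leq_trans; apply. Qed.

Lemma smooth_leq i c : 0 < c <= i -> (upto i).-nat c.
Proof.
move=> /andP[c0 ci]; apply/pnatP => // p _ /dvdn_leq => /(_ c0) pc.
by rewrite inE (leq_trans pc).
Qed.

(** Translates the condition on P^+ in the definition of [C_]. Positivity of i matters for d = 1,
    where [max_pdiv 1 = 1]. *)
Lemma smoothE i d : 0 < i -> 0 < d -> (max_pdiv d <= i) = (upto i).-nat d.
Proof.
move=> i0 d0; apply/idP/(pnatP _ d0) => [h p pp pd|h].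
  by rewrite inE (leq_trans _ h) //; apply: max_pdiv_max; rewrite mem_primes pp d0.
have [d1|d1] := ltnP 1 d; last by have -> : d = 1 by lia.
by have := h _ (max_pdiv_prime d1) (max_pdiv_dvd d); rewrite inE.
Qed.

Lemma rough_part_smooth i c : (upto i).-nat c -> rough_part i c = 1.
Proof. by move=> h; apply: part_p'nat; rewrite pnatNK. Qed.

Lemma smooth_part_rough i c : (upto i)^'.-nat c -> smooth_part i c = 1.
Proof. exact: part_p'nat. Qed.

Lemma rough_partM i a c : 0 < a -> 0 < c ->
  rough_part i (a * c) = rough_part i a * rough_part i c.
Proof. exact: partnM. Qed.

Lemma smooth_partM i a c : 0 < a -> 0 < c ->
  smooth_part i (a * c) = smooth_part i a * smooth_part i c.
Proof. exact: partnM. Qed.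

Lemma parts_mul i m : 0 < m -> smooth_part i m * rough_part i m = m.
Proof. exact: partnC. Qed.

Lemma rough_part_gt0 i m : 0 < rough_part i m.
Proof. exact: part_gt0. Qed.

Lemma smooth_part_gt0 i m : 0 < smooth_part i m.
Proof. exact: part_gt0. Qed.

Lemma rough_part_nat i m : (upto i)^'.-nat (rough_part i m).
Proof. exact: part_pnat. Qed.

Lemma smooth_part_nat i m : (upto i).-nat (smooth_part i m).
Proof. exact: part_pnat. Qed.

Lemma rough_part_id i k : (upto i)^'.-nat k -> rough_part i k = k.
Proof. exact: part_pnat_id. Qed.

Lemma smooth_part_id i k : (upto i).-nat k -> smooth_part i k = k.
Proof. exact: part_pnat_id. Qed.

End Parts.

Section Localization.
Local Open Scope fset_scope.
Local Open Scope ring_scope.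
Variables (R : realType) (Psi : {fset nat} -> R).
Hypothesis Psi_add : divisor_additive Psi.

Lemma mem_nat_interval a b k : (k \in nat_interval a b) = (a <= k <= b)%N.
Proof. by rewrite /nat_interval !inE /= mem_index_iota ltnS. Qed.

Lemma Psi0 : Psi fset0 = 0.
Proof.
have h : Psi (fset0 `|` fset0) = Psi fset0 + Psi fset0.
  by apply: dadd_U; rewrite ?in_fset0 ?fdisjoint0X // => a b; rewrite in_fset0.
by move: h; rewrite fsetU0; lra.
Qed.

(** The g(m, n) of the overview and the numerator of [C_term]. *)
Definition gain (d t : nat) : R :=
  Psi (nat_interval d t) - Psi (nat_interval d.+1 t).

Lemma gain_le1 d t : `|gain d t| <= 1.
Proof.
rewrite /gain; have [dt|td] := leqP d t; last first.
  suff -> : nat_interval d t = nat_interval d.+1 t by rewrite subrr normr0 ler01.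
  by apply/fsetP => x; rewrite !mem_nat_interval; lia.
suff -> : nat_interval d t = d |` nat_interval d.+1 t by apply: dadd_U1.
by apply/fsetP => x; rewrite in_fset1U !mem_nat_interval; lia.
Qed.

Lemma Psi_telescope n : Psi (nat_interval 1 n) = \sum_(1 <= m < n.+1) gain m n.
Proof.
pose u m := - Psi (nat_interval m n).
rewrite (@eq_big_nat _ _ _ 1%N n.+1 _ (fun m => u m.+1 - u m)); last first.
  by move=> m _; rewrite /gain /u opprK addrC.
rewrite telescope_sumr // /u opprK.
suff -> : nat_interval n.+1 n = fset0 by rewrite Psi0 oppr0 add0r.
by apply/fsetP => x; rewrite mem_nat_interval in_fset0; lia.
Qed.

Lemma mem_interval_filter (p : pred nat) a n x :
  (x \in [fset x in nat_interval a n | p x]) = (a <= x <= n)%N && p x.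
Proof. by rewrite -mem_nat_interval in_fset. Qed.

Definition class (i k a n : nat) : {fset nat} :=
  [fset x in nat_interval a n | rough_part i x == k].

Lemma mem_class i k a n x :
  (x \in class i k a n) = (a <= x <= n)%N && (rough_part i x == k).
Proof. by rewrite /class mem_interval_filter. Qed.

(* If x divides y and both lie in [a, n], the quotient y / x is at most i,
   hence i-smooth, so x and y have the same i-rough part. *)
Lemma Psi_split i k a n : (0 < a)%N -> (n < i.+1 * a)%N ->
  Psi (nat_interval a n) = Psi (class i k a n) +
    Psi [fset x in nat_interval a n | rough_part i x != k].
Proof.
move=> a0 nia; rewrite -dadd_U //.
- congr Psi; apply/fsetP => x.
  rewrite in_fsetU mem_class mem_interval_filter mem_nat_interval.
  by case: (_ == k); rewrite ?andbT ?andbF ?orbF.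
- by rewrite mem_class leqNgt a0.
- by rewrite mem_interval_filter leqNgt a0.
- by apply/fdisjointP => x; rewrite mem_class mem_interval_filter => /andP[_ ->]; rewrite andbF.
have key x y : (a <= x <= n)%N -> (a <= y <= n)%N -> (x %| y)%N ->
    rough_part i x = rough_part i y.
  move=> hx hy /dvdnP[c e]; rewrite {}e in hy *.
  have c0 : (0 < c)%N by case: c hy => //; lia.
  rewrite rough_partM //; last by lia.
  rewrite (@rough_part_smooth i c) ?mul1n //; apply: smooth_leq.
  by rewrite c0 /= -ltnS -(ltn_pmul2r a0); nia.
move=> x y; rewrite mem_class mem_interval_filter.
move=> /andP[hx /eqP xk] /andP[hy yk].
split; apply/negP => /key => h; move: yk.
  by rewrite -h // xk eqxx.
by rewrite h // xk eqxx.
Qed.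

(** Passing from [m, n] to [m + 1, n] loses only m, which lies in the class of its own rough part;
    the complements of this class therefore agree and cancel. *)
Lemma gain_class i m n : (0 < m)%N -> (n < i.+1 * m)%N ->
  gain m n = Psi (class i (rough_part i m) m n)
             - Psi (class i (rough_part i m) m.+1 n).
Proof.
move=> m0 nim; rewrite /gain.
rewrite (Psi_split (i := i) (rough_part i m) m0 nim).
rewrite (Psi_split (i := i) (a := m.+1) (rough_part i m)) //; last by lia.
suff -> : [fset x in nat_interval m n | rough_part i x != rough_part i m] =
  [fset x in nat_interval m.+1 n | rough_part i x != rough_part i m].
  by rewrite opprD addrACA subrr addr0.
apply/fsetP => x; rewrite !mem_interval_filter.
by have [->|] := eqVneq x m; [rewrite eqxx !andbF | lia].
Qed.

(** The lower ends a and b are parameters because two cases occur for m = d k: (a, b) = (m, d), and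
    (m + 1, d + 1), where k e > d k means e > d. *)
Lemma class_dilate i k a b n : (upto i)^'.-nat k -> (0 < a)%N -> (0 < b)%N ->
  (forall e, (a <= k * e)%N = (b <= e)%N) ->
  class i k a n = dilate k (class i 1 b (n %/ k)).
Proof.
move=> kr a0 b0 ab; have k0 : (0 < k)%N by case/andP: kr.
apply/fsetP => x; rewrite mem_class; apply/andP/imfsetP => /= [[h /eqP e]|[y]].
  have x0 : (0 < x)%N by lia.
  exists (smooth_part i x); last by rewrite -e mulnC parts_mul.
  rewrite mem_class -ab leq_divRL // -e.
  by rewrite [X in (a <= X)%N]mulnC parts_mul // h (rough_part_smooth (smooth_part_nat i x)).
rewrite mem_class leq_divRL // => /andP[h /eqP e] ->.
have y0 : (0 < y)%N by lia.
by rewrite ab mulnC h rough_partM // e mul1n rough_part_id.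
Qed.

Lemma gain_local m n : (0 < m)%N -> (m <= n)%N ->
  gain m n = gain (smooth_part (n %/ m) m) (n %/ rough_part (n %/ m) m).
Proof.
move=> m0 mn; set i := (n %/ m)%N; set d := smooth_part i m; set k := rough_part i m.
have d0 : (0 < d)%N by apply: smooth_part_gt0.
have k0 : (0 < k)%N by apply: rough_part_gt0.
have dk : (d * k = m)%N by apply: parts_mul.
have kr : (upto i)^'.-nat k by apply: rough_part_nat.
have rd : rough_part i d = 1%N by apply: rough_part_smooth; apply: smooth_part_nat.
have nim : (n < i.+1 * m)%N by rewrite -ltn_divLR.
have nid : (n %/ k < i.+1 * d)%N by rewrite ltn_divLR // -mulnA dk.
rewrite (gain_class (i := i) m0 nim) (gain_class (i := i) d0 nid) rd.
rewrite -/k (class_dilate (b := d) _ kr m0) //; last first.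
  by move=> e; rewrite -dk mulnC leq_pmul2l.
rewrite (class_dilate (b := d.+1) (a := m.+1) _ kr) //; last first.
  by move=> e; rewrite -dk mulnC ltn_pmul2l.
by rewrite !(dadd_dilate Psi_add) // mem_class leqNgt ?d0.
Qed.

End Localization.

(** * Smooth and rough numbers *)

Lemma big_multiples (T : Type) (idx : T) (op : Monoid.com_law idx) (p N : nat)
    (D : pred nat) (F : nat -> T) : (0 < p)%N ->
  \big[op/idx]_(1 <= k < N.+1 | (p %| k)%N && D k) F k =
  \big[op/idx]_(1 <= k < (N %/ p).+1 | D (p * k)%N) F (p * k)%N.
Proof.
move=> p0; rewrite -big_filter -[RHS]big_filter -[RHS](big_map (muln p) xpredT F).
apply/perm_big/uniq_perm; first exact/filter_uniq/iota_uniq.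
  rewrite map_inj_uniq; first exact/filter_uniq/iota_uniq.
  by move=> x y /eqP; rewrite eqn_mul2l eqn0Ngt p0 => /eqP.
move=> x; rewrite mem_filter mem_index_iota; apply/idP/mapP => [|[k]].
  move=> /andP[/andP[/dvdnP[k ->] Dk] hx]; exists k; last by rewrite mulnC.
  by rewrite mem_filter mulnC Dk mem_index_iota ltnS leq_divRL //; case: k hx {Dk}; lia.
rewrite mem_filter mem_index_iota ltnS leq_divRL // => /andP[Dk hk] ->.
by rewrite dvdn_mulr // Dk /= mulnC; nia.
Qed.

Section SmoothRough.
Local Open Scope nat_scope.

Lemma rough0 k : 0 < k -> (upto 0)^'.-nat k.
Proof. by move=> k0; apply/pnatP => // p /prime_gt0; rewrite !inE /=; lia. Qed.

Lemma smooth0 d : 0 < d -> (upto 0).-nat d = (d == 1).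
Proof.
move=> d0; apply/idP/eqP => [h|-> //].
by rewrite -(parts_mul 0 d0) (rough_part_smooth h) muln1 (smooth_part_rough (rough0 d0)).
Qed.

(** Inductions run over all integers i instead of the primes: the step from i to i + 1 changes
    something only if i + 1 is prime. *)
Lemma upto_nonprime i k : ~~ prime i.+1 -> (upto i.+1).-nat k = (upto i).-nat k.
Proof.
move=> np; case: (posnP k) => [->//|k0].
apply/idP/idP => /pnatP h; apply/pnatP => // p pp pk; move: (h k0 p pp pk);
  rewrite !inE; last lia.
by rewrite leq_eqVlt => /orP[/eqP e|//]; rewrite -e pp in np.
Qed.

Lemma rough_nonprime i k :
  ~~ prime i.+1 -> (upto i.+1)^'.-nat k = (upto i)^'.-nat k.
Proof.
move=> np; case: (posnP k) => [->//|k0].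
apply/idP/idP => /pnatP h; apply/pnatP => // p pp pk; move: (h k0 p pp pk);
  rewrite !inE; first lia.
by rewrite -!ltnNge => h1; rewrite ltn_neqAle h1 andbT; apply: contraNneq np => ->.
Qed.

Lemma rough_prime i k : prime i.+1 -> 0 < k ->
  (upto i.+1)^'.-nat k = ~~ (i.+1 %| k) && (upto i)^'.-nat k.
Proof.
move=> pi k0; apply/idP/idP => [/pnatP h|/andP[nd /pnatP h]].
  apply/andP; split.
    by apply/negP => /(h k0 _ pi); rewrite !inE leqnn.
  by apply/pnatP => // p pp pk; move: (h k0 p pp pk); rewrite !inE; lia.
apply/pnatP => // p pp pk; move: (h k0 p pp pk); rewrite !inE.
by rewrite -!ltnNge => h1; rewrite ltn_neqAle h1 andbT; apply: contraNneq nd => ->.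
Qed.

Lemma smooth_prime i k : prime i.+1 -> 0 < k -> ~~ (i.+1 %| k) ->
  (upto i.+1).-nat k = (upto i).-nat k.
Proof.
move=> pi k0 nd; apply/idP/idP => /pnatP h; apply/pnatP => // p pp pk;
  move: (h k0 p pp pk); rewrite !inE; last lia.
by rewrite leq_eqVlt => /orP[/eqP e|//]; rewrite -e pk in nd.
Qed.

(** For t > 0 the condition on k is that it lies in (N / (t + 1), N / t]. Written with a floor, it
    passes from k = p k' to the same condition on k' for N %/ p. *)
Definition rough_count i N t :=
  \sum_(1 <= k < N.+1 | (upto i)^'.-nat k && (N %/ k == t)) 1.

Lemma rough_count0 N t : 0 < t -> rough_count 0 N t = N %/ t - N %/ t.+1.
Proof.
move=> t0; rewrite /rough_count big_nat_cond.
rewrite (eq_bigl (fun k => (1 <= k < N.+1) && (N %/ t.+1 < k <= N %/ t))); last first.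
  move=> k; case: (boolP (1 <= k < N.+1)) => //= /andP[k0 kN].
  rewrite rough0 // ltn_divLR // leq_divRL // eqn_leq -(ltnS _ t) ltn_divLR //.
  by rewrite leq_divRL // mulnC (mulnC k t).
have le1 : N %/ t <= N by apply: leq_div.
have le2 : N %/ t.+1 <= N %/ t by apply: leq_div2l.
rewrite -big_nat_cond -big_filter sum1_size size_filter.
rewrite (_ : count _ _ = size (index_iota (N %/ t.+1).+1 (N %/ t).+1)); last first.
  rewrite -size_filter; apply/perm_size/uniq_perm; rewrite ?filter_uniq ?iota_uniq //.
  move=> k; rewrite mem_filter !mem_index_iota.
  by move: (N %/ t) (N %/ t.+1) le1 le2 => a b; lia.
by rewrite size_iota subSS.
Qed.

Lemma rough_count_nonprime i N t :
  ~~ prime i.+1 -> rough_count i.+1 N t = rough_count i N t.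
Proof. by move=> np; apply: eq_bigl => k; rewrite rough_nonprime. Qed.

(** An i-rough k that is not (i + 1)-rough is a multiple of the prime i + 1, with an i-rough
    cofactor. *)
Lemma rough_count_prime i N t : prime i.+1 ->
  rough_count i N t = rough_count i.+1 N t + rough_count i (N %/ i.+1) t.
Proof.
move=> pi; rewrite /rough_count (bigID (fun k => i.+1 %| k)) /= addnC; congr addn.
  rewrite big_nat_cond [RHS]big_nat_cond; apply: eq_bigl => k.
  case: (boolP (1 <= k < _)) => //= /andP[k0 _].
  by rewrite rough_prime // andbC andbA.
under eq_bigl => k do rewrite andbC.
rewrite big_multiples //; apply: eq_bigl => k; rewrite pnatM divnMA.
suff -> : (upto i)^'.-nat i.+1 by [].
by rewrite pnatE // !inE ltnn.
Qed.

End SmoothRough.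

(** * Euler product bounds for sums over smooth numbers *)

Section EulerProduct.
Variables (R : realType) (w : nat -> R).
Hypotheses (w_ge0 : forall d, 0 <= w d) (w1 : w 1%N = 1)
  (wM : forall a b, (0 < a)%N -> (0 < b)%N -> w (a * b)%N = w a * w b)
  (w_lt1 : forall p, prime p -> w p < 1).

Definition smooth_sum i N : R := \sum_(1 <= d < N.+1 | (upto i).-nat d) w d.

Lemma smooth_sum_le i N M : (N <= M)%N -> smooth_sum i N <= smooth_sum i M.
Proof.
move=> NM; rewrite /smooth_sum (@big_cat_nat _ _ _ N.+1 1%N M.+1) //=.
by rewrite lerDl sumr_ge0.
Qed.

(** Let p = i + 1 be prime. The terms divisible by p add up to at most w p times the whole (i +
    1)-smooth sum, so (1 - w p) times that sum is at most the i-smooth sum; no geometric series is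
    expanded. *)
Lemma smooth_sum_le_prod i N :
  smooth_sum i N <= \prod_(1 <= p < i.+1 | prime p) (1 - w p)^-1.
Proof.
elim: i => [|i IH].
  rewrite big_geq // /smooth_sum big_nat_cond.
  rewrite (eq_bigl (fun d => (1 <= d < N.+1)%N && (d == 1%N))); last first.
    by move=> d; case: (boolP (1 <= d < _)%N) => //= /andP[d0 _]; rewrite smooth0.
  case: N => [|N]; first by rewrite -big_nat_cond big_geq.
  rewrite -big_nat_cond big_ltn_cond //= w1 big_nat_cond big_pred0 ?addr0 //.
  by move=> d; lia.
rewrite big_mkcond big_nat_recr //= -big_mkcond /=.
case: (boolP (prime i.+1)) => [pi|np]; last first.
  rewrite mulr1; apply: le_trans IH.
  by rewrite /smooth_sum (eq_bigl _ _ (fun k => upto_nonprime k np)).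
have w_gt0 : 0 < 1 - w i.+1 by rewrite subr_gt0 w_lt1.
rewrite ler_pdivlMr //; apply: le_trans IH.
rewrite mulrBr mulr1 lerBlDr {1}/smooth_sum (bigID (fun k => i.+1 %| k)%N) /=.
rewrite addrC lerD //.
  rewrite /smooth_sum [leRHS](bigID (fun k => i.+1 %| k)%N) /=.
  rewrite ler_wpDl ?sumr_ge0 // le_eqVlt; apply/orP; left; apply/eqP.
  rewrite big_nat_cond [RHS]big_nat_cond; apply: eq_bigl => k.
  case: (boolP (1 <= k < _)%N) => //= /andP[k0 _].
  by rewrite -!(andbC (~~ _)); case: (boolP (i.+1 %| k)%N) => //= nd; rewrite smooth_prime.
under eq_bigl => k do rewrite andbC.
rewrite big_multiples // (eq_bigl (upto i.+1).-nat); last first.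
  move=> k; rewrite pnatM; suff -> : (upto i.+1).-nat i.+1 by [].
  by rewrite pnatE // !inE leqnn.
rewrite big_nat_cond (eq_bigr (fun k => w k * w i.+1)) -?big_nat_cond; last first.
  by move=> k /andP[/andP[k0 _] _]; rewrite wM // mulrC.
by rewrite -mulr_suml ler_wpM2r // smooth_sum_le // leq_div.
Qed.

End EulerProduct.

(** * Brun's sieve *)

Section Sieve.
Variable R : realType.

Definition psum (i : nat) : R := \sum_(1 <= p < i.+1 | prime p) (p%:R)^-1.

Lemma psum_ge0 i : 0 <= psum i.
Proof. by apply: sumr_ge0 => p _; rewrite invr_ge0 ler0n. Qed.

Lemma psumS i : psum i.+1 = psum i + (if prime i.+1 then (i.+1%:R)^-1 else 0).
Proof. by rewrite /psum big_mkcond big_nat_recr //= -big_mkcond. Qed.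

Lemma le_psum i j : (i <= j)%N -> psum i <= psum j.
Proof.
move=> ij; rewrite /psum (@big_cat_nat _ _ _ i.+1 1%N j.+1) //=.
by rewrite lerDl sumr_ge0 // => p _; rewrite invr_ge0 ler0n.
Qed.

Lemma euler_factorS i : euler_factor R i.+1 =
  euler_factor R i * (if prime i.+1 then (i.+1%:R - 1) / i.+1%:R else 1).
Proof. by rewrite /euler_factor big_mkcond big_nat_recr //= -big_mkcond. Qed.

Lemma euler_factor_itv i : 0 < euler_factor R i <= 1.
Proof.
elim: i => [|i /andP[h0 h1]]; first by rewrite /euler_factor big_geq // ltr01 lexx.
rewrite euler_factorS; case: ifP => [pi|_]; last by rewrite mulr1 h0.
have i1 : 1 < i.+1%:R :> R by rewrite ltr1n; apply: prime_gt1.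
rewrite mulr_gt0 //=; last by rewrite divr_gt0 ?subr_gt0 ?ltr0n.
apply: mulr_ile1; [exact: ltW | by rewrite divr_ge0 ?subr_ge0 // ltW | by [] | ].
by rewrite ler_pdivrMr ?ltr0n // mul1r; lra.
Qed.

Lemma divn_real n d : (0 < d)%N ->
  ((n %/ d)%:R <= n%:R / d%:R :> R) && (n%:R / d%:R < (n %/ d)%:R + 1 :> R).
Proof.
move=> d0; rewrite ler_pdivlMr ?ltr0n // ltr_pdivrMr ?ltr0n //.
by rewrite -natrM -[1]/(1%:R) -natrD -natrM ler_nat ltr_nat leq_divM addn1 ltn_ceil.
Qed.

Lemma rough_count_le i N t : (rough_count i N t <= rough_count 0 N t)%N.
Proof.
rewrite /rough_count big_mkcond [leqRHS]big_mkcond /= !big_nat.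
apply: leq_sum => k /andP[k0 _]; rewrite rough0 //=.
by case: (_ %/ _ == t)%N; rewrite ?andbF ?andbT //; case: ifP.
Qed.

(** The count is a difference of two floors; both rounding errors lie in [0, 1), so they differ by
    at most 1. *)
Lemma rough_count0_approx n e t : (0 < e)%N -> (0 < t)%N ->
  `|(rough_count 0 (n %/ e) t)%:R - n%:R / (t * t.+1)%:R / e%:R| <= 1 :> R.
Proof.
move=> e0 t0; rewrite rough_count0 //.
rewrite natrB ?leq_div2l // -!divnMA.
have := divn_real n (d := (e * t)%N); have := divn_real n (d := (e * t.+1)%N).
rewrite !muln_gt0 e0 t0 /= => /(_ isT) /andP[a1 a2] /(_ isT) /andP[b1 b2].
have -> : n%:R / (t * t.+1)%:R / e%:R = n%:R / (e * t)%:R - n%:R / (e * t.+1)%:R :> R.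
  have ? : t%:R != 0 :> R by rewrite pnatr_eq0; lia.
  have ? : e%:R != 0 :> R by rewrite pnatr_eq0; lia.
  have ? : t%:R + 1 != 0 :> R by rewrite natr1 pnatr_eq0.
  by rewrite !natrM -!natr1; field; apply/and3P.
move: (n%:R / (e * t.+1)%:R : R) ((n %/ (e * t.+1))%:R : R) a1 a2.
move: (n%:R / (e * t)%:R : R) ((n %/ (e * t))%:R : R) b1 b2 => A a h1 h2 B b h3 h4.
by rewrite ler_norml; apply/andP; split; lra.
Qed.

(** Two terms of the binomial expansion. With a = [psum i] and b = 1 / p, this adds the prime p to
    the sieve remainder a ^ r / r!. *)
Lemma bernoulli_exp (a b : R) r : 0 <= a -> 0 <= b ->
  a ^+ r.+1 + r.+1%:R * b * a ^+ r <= (a + b) ^+ r.+1.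
Proof.
move=> a0 b0; elim: r => [|r IH]; first by rewrite !expr1 expr0; lra.
rewrite [leRHS]exprS.
apply: le_trans (ler_wpM2l (addr_ge0 a0 b0) IH).
rewrite [a ^+ r.+2]exprS [a ^+ r.+1]exprS -[r.+2%:R]natr1.
have := exprn_ge0 r a0; set x := a ^+ r; set y := r.+1%:R => x0.
have y0 : 0 <= y by apply: ler0n.
rewrite -subr_ge0.
have -> : (a + b) * (a * x + y * b * x) - (a * (a * x) + (y + 1) * b * (a * x)) = b * b * y * x by ring.
by rewrite !mulr_ge0.
Qed.

(* Buchstab's identity (rough_count_prime) removes one prime p at a time; the
   level r is lowered by one on the term n / (e p), so that r bounds the number
   of primes removed, and level 0 is the trivial bound. *)
Theorem brun_sieve i n e t r : (0 < e)%N -> (0 < t)%N ->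
  `|(rough_count i (n %/ e) t)%:R
    - euler_factor R i * (n%:R / (t * t.+1)%:R / e%:R)|
  <= i.+1%:R ^+ r + n%:R / (t * t.+1)%:R / e%:R * (psum i ^+ r / r`!%:R).
Proof.
move=> + t0; set X := n%:R / (t * t.+1)%:R.
have X0 : 0 <= X by rewrite divr_ge0 ?ler0n.
have Xe0 e' : 0 <= X / e'%:R by rewrite divr_ge0 ?ler0n.
have term0 j q : 0 <= psum j ^+ q / q`!%:R.
  by rewrite divr_ge0 ?exprn_ge0 ?psum_ge0 ?ler0n.
elim: i e r => [|i IH] e r e0.
  rewrite [euler_factor _ _]big_geq // mul1r expr1n.
  apply: le_trans (rough_count0_approx n e0 t0) _.
  by rewrite lerDl mulr_ge0.
case: r => [|r].
  (* Level 0: the count and its prediction both lie between 0 and 1 + X / e. *)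
  rewrite !expr0 fact0 divr1 mulr1.
  have := rough_count0_approx n e0 t0; rewrite -/X ler_norml => /andP[_ h].
  have h1 : (rough_count i.+1 (n %/ e) t)%:R <= (rough_count 0 (n %/ e) t)%:R :> R.
    by rewrite ler_nat rough_count_le.
  have h2 : 0 <= (rough_count i.+1 (n %/ e) t)%:R :> R by apply: ler0n.
  have /andP[w0 w1] := euler_factor_itv i.+1.
  have h3 : euler_factor R i.+1 * (X / e%:R) <= X / e%:R by rewrite ler_piMl.
  have h4 : 0 <= euler_factor R i.+1 * (X / e%:R) by rewrite mulr_ge0 // ltW.
  by rewrite ler_norml; apply/andP; split; move: h h1 h2 h3 h4; lra.
have p0 := psum_ge0 i.
case: (boolP (prime i.+1)) => pi; last first.
  rewrite rough_count_nonprime // euler_factorS psumS (negPf pi) mulr1 addr0.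
  apply: le_trans (IH _ r.+1 e0) _; rewrite lerD2r.
  by rewrite lerXn2r ?nnegrE ?ler0n // ler_nat.
rewrite euler_factorS psumS pi.
have i0 : i.+1%:R != 0 :> R by rewrite pnatr_eq0.
have eN0 : e%:R != 0 :> R by rewrite pnatr_eq0 -lt0n.
have := IH e r.+1 e0; have := IH (e * i.+1)%N r; rewrite muln_gt0 e0 => /(_ isT).
rewrite divnMA; have := rough_count_prime (n %/ e) t pi.
move: (rough_count _ _ _) => a; move: (rough_count _ _ _) => b.
move: (rough_count _ _ _) => c -> {a} hc hb.
set w := euler_factor R i in hb hc *.
have -> : b%:R - w * ((i.+1%:R - 1) / i.+1%:R) * (X / e%:R) =
  ((b + c)%:R - w * (X / e%:R)) - (c%:R - w * (X / (e * i.+1)%:R)).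
  by rewrite natrD natrM; move: (i.+1%:R) i0 => q q0; field; rewrite q0 eN0.
apply: (le_trans (ler_normB _ _)); apply: (le_trans (lerD hb hc)).
set s := psum i in p0 *; set p := (i.+1%:R)^-1.
have p_ge0 : 0 <= p by rewrite invr_ge0 ler0n.
have -> : X / (e * i.+1)%:R = X / e%:R * p by rewrite natrM invfM mulrA.
rewrite addrACA; apply: lerD.
  (* (i + 1) ^ (r + 1) + (i + 1) ^ r = (i + 2) (i + 1) ^ r. *)
  rewrite exprS -[X in _ + X]mul1r -mulrDl natr1.
  rewrite [leRHS]exprS ler_wpM2l ?ler0n //.
  by rewrite lerXn2r ?nnegrE ?ler0n // ler_nat.
rewrite -[X in _ + X]mulrA -mulrDr ler_wpM2l //.
have f0 : 0 < r.+1`!%:R :> R by rewrite ltr0n fact_gt0.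
rewrite ler_pdivlMr // mulrDl divfK ?gt_eqF //.
apply: le_trans (bernoulli_exp r p0 p_ge0).
rewrite lerD2l factS natrM; have g0 : r`!%:R != 0 :> R by rewrite pnatr_eq0 -lt0n fact_gt0.
by rewrite le_eqVlt; apply/orP; left; apply/eqP; field.
Qed.

End Sieve.

(* The primes of (m, 2m] all divide 'C(2m, m) <= 4 ^ m. *)
Section Chebyshev.
Local Open Scope nat_scope.

Lemma dvdn_prod_primes (s : seq nat) N : uniq s ->
  {in s, forall p, prime p && (p %| N)} -> \prod_(p <- s) p %| N.
Proof.
elim: s => [|p s IH] /=; first by rewrite big_nil dvd1n.
move=> /andP[ps us] h; rewrite big_cons Gauss_dvd.
  have /andP[_ ->] /= := h p (mem_head _ _).
  by apply: IH => // q qs; apply: h; rewrite inE qs orbT.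
have /andP[pp _] := h p (mem_head _ _).
rewrite big_seq; elim/big_rec: _ => [|q x qs]; first exact: coprimen1.
rewrite coprimeMr => ->; rewrite andbT prime_coprime //.
have /andP[pq _] : prime q && (q %| N) by apply: h; rewrite inE qs orbT.
by rewrite dvdn_prime2 //; apply: contraNneq ps => ->.
Qed.

Lemma leq_bin_exp n k : 'C(n, k) <= 2 ^ n.
Proof.
have [kn|nk] := leqP k n; last by rewrite bin_small.
rewrite -[2]/(1 + 1) expnDn (bigD1 (inord k : 'I_n.+1)) //= inordK ?ltnS //.
by rewrite !exp1n !muln1 leq_addr.
Qed.

Definition primes_in m := [seq p <- index_iota m.+1 (2 * m).+1 | prime p].

Lemma expn_primes_in m : m ^ size (primes_in m) <= 2 ^ (2 * m).
Proof.
apply: leq_trans (leq_bin_exp _ m).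
apply: (@leq_trans (\prod_(p <- primes_in m) p)).
  have : all (fun p => m <= p) (primes_in m).
    by apply/allP => p; rewrite mem_filter mem_index_iota => /andP[_ /andP[/ltnW]].
  elim: (primes_in m) => [|p s IH] /=; first by rewrite big_nil.
  by move=> /andP[mp /IH h]; rewrite big_cons expnS leq_mul.
apply: dvdn_leq; first by rewrite bin_gt0; lia.
apply: dvdn_prod_primes; first exact/filter_uniq/iota_uniq.
move=> p; rewrite mem_filter mem_index_iota => /andP[pp hp]; rewrite pp /=.
have : p %| (2 * m)`! by apply: dvdn_fact; lia.
rewrite -(@bin_fact (2 * m) m); last by lia.
rewrite Euclid_dvdM // Euclid_dvdM //.
have nd q : q <= m -> ~~ (p %| q`!).
  elim: q => [|q IH] qm; first by rewrite fact0 dvdn1; case: eqP pp => // ->.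
  rewrite factS Euclid_dvdM // negb_or IH ?andbT; last by lia.
  by apply/negP => /dvdn_leq; lia.
by rewrite !(negPf (nd _ _)) ?orbF //; lia.
Qed.

Lemma size_primes_in j : j * size (primes_in (2 ^ j)) <= 2 * 2 ^ j.
Proof. by have := expn_primes_in (2 ^ j); rewrite -expnM leq_exp2l. Qed.

End Chebyshev.

(** * The sum of the reciprocals of the primes *)

Section PrimeSum.
Variable R : realType.

(** The block (2 ^ j, 2 ^ (j + 1)] has at most 2 ^ (j + 1) / j primes, each contributing at most 2 ^
    (- j). The leading 1 covers p = 2. *)
Lemma psum_exp2 J :
  psum R (2 ^ J.+1)%N <= 1 + \sum_(1 <= j < J.+1) 2%:R / j%:R.
Proof.
elim: J => [|J IH].
  rewrite [X in _ + X]big_geq // addr0 /psum expn1 big_mkcond /index_iota /= !big_cons big_nil /=.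
  by rewrite !(add0r, addr0) invf_le1 ?ltr0n // ler1n.
rewrite big_nat_recr //= addrA; apply: le_trans (lerD IH (lexx _)).
rewrite [X in X <= _]/psum (@big_cat_nat _ _ _ (2 ^ J.+1).+1 1%N (2 ^ J.+2).+1) //=; last first.
  by rewrite ltnS leq_exp2l.
rewrite lerD2l -big_filter.
have -> : [seq p <- index_iota (2 ^ J.+1).+1 (2 ^ J.+2).+1 | prime p] = primes_in (2 ^ J.+1).
  by rewrite /primes_in -expnS.
have m0 : 0 < (2 ^ J.+1)%:R :> R by rewrite ltr0n expn_gt0.
apply: (@le_trans _ _ (\sum_(p <- primes_in (2 ^ J.+1)) ((2 ^ J.+1)%:R)^-1)).
  rewrite big_seq [leRHS]big_seq; apply: ler_sum => p.
  rewrite mem_filter mem_index_iota => /andP[_ /andP[h _]].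
  by rewrite lef_pV2 ?posrE ?ltr0n ?ler_nat ?expn_gt0 //; lia.
rewrite big_const_seq count_predT iter_addr_0 -[leLHS]mulr_natr mulrC.
rewrite ler_pdivrMr // mulrAC ler_pdivlMr ?ltr0n // -!natrM ler_nat mulnC.
exact: size_primes_in.
Qed.

Lemma harmonic_le J : \sum_(1 <= j < J.+2) 2%:R / j%:R <= 2 + 2 * ln (J.+1%:R : R).
Proof.
elim: J => [|J IH]; first by rewrite big_nat1 ln1 divr1 mulr0 addr0.
rewrite big_nat_recr //=; apply: le_trans (lerD IH (lexx _)) _.
rewrite -addrA lerD2l.
rewrite -mulrDr ler_pM2l ?ltr0n // -lerBrDl.
rewrite -[leLHS]opprK lerNl opprB -ln_div ?posrE ?ltr0n //.
have -> : J.+1%:R / J.+2%:R = 1 + - (J.+2%:R)^-1 :> R.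
  by rewrite -{1}[J.+1%:R](addrK 1) natr1 mulrBl divff ?pnatr_eq0 // mul1r.
by apply: le_ln1Dx; rewrite ltrN2 invf_lt1 ?ltr0n // ltr1n.
Qed.

(** A weak form of Mertens' theorem, of order ln ln i. The constants are immaterial: the bound only
    has to grow more slowly than every power of ln n. *)
Lemma psum_le i J : (i <= 2 ^ J.+2)%N -> psum R i <= 3 + 2 * ln (J.+1%:R : R).
Proof.
move=> iJ; apply: le_trans (le_psum R iJ) _; apply: le_trans (psum_exp2 _) _.
by have := harmonic_le J; lra.
Qed.

End PrimeSum.

(** * Grouping the increments by (n / m, smooth part of m) *)

Section Regrouping.
Variables (R : realType) (g : nat -> nat -> R).
Hypothesis g_le1 : forall d t, `|g d t| <= 1.

(** For g = [gain Psi] this is Psi [1, n], by [gain_local]. *)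
Definition local_sum (n : nat) : R := \sum_(1 <= m < n.+1)
  g (smooth_part (n %/ m) m) (n %/ rough_part (n %/ m) m).

Definition term (i d : nat) : R :=
  \sum_((i * d)%N <= t < (i.+1 * d)%N) g d t / (t * t.+1)%N%:R.

Definition Cpart (I N : nat) : R := \sum_(1 <= i < I)
  euler_factor R i * \sum_(1 <= d < N.+1 | (upto i).-nat d) term i d.

(** The part of [local_sum] with n / m < I and smooth part at most D, sorted by i = n / m, by d, and
    by t = n / k. *)
Definition Apart (I D n : nat) : R := \sum_(1 <= i < I)
  \sum_(1 <= d < D.+1 | (upto i).-nat d)
    \sum_((i * d)%N <= t < (i.+1 * d)%N) g d t * (rough_count i n t)%:R.

Lemma smooth_rough_uniq i d m : (0 < m)%N -> (upto i).-nat d ->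
  ((d %| m) && (upto i)^'.-nat (m %/ d))%N = (smooth_part i m == d).
Proof.
move=> m0 sd; have d0 : (0 < d)%N by case/andP: sd.
apply/andP/eqP => [[/dvdnP[k e]]|<-].
  rewrite e mulnK // => rk; have k0 : (0 < k)%N by case/andP: rk.
  by rewrite smooth_partM // smooth_part_rough // mul1n smooth_part_id.
split; first exact: dvdn_part.
by rewrite -{1}(parts_mul i m0) mulKn ?smooth_part_gt0 // rough_part_nat.
Qed.

(** Both sides run over m = d k with k i-rough: t = n / k lies in [i d, (i + 1) d) exactly when n /
    m = i. *)
Lemma sum_rough_fiber n i d : (0 < i)%N -> (upto i).-nat d ->
  \sum_((i * d)%N <= t < (i.+1 * d)%N) g d t * (rough_count i n t)%:R =
  \sum_(1 <= m < n.+1 | (n %/ m == i)%N && (smooth_part i m == d))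
    g d (n %/ rough_part i m).
Proof.
move=> i0 sd; have d0 : (0 < d)%N by case/andP: sd.
under eq_bigr => t _ do rewrite /rough_count natr_sum mulr_sumr big_mkcond /=.
rewrite exchange_big_nat /=.
transitivity (\sum_(1 <= k < n.+1 | (upto i)^'.-nat k && (n %/ (d * k) == i)%N) g d (n %/ k)).
  rewrite [RHS]big_mkcond /= !big_nat; apply: eq_bigr => k /andP[k0 kn].
  case: (boolP ((upto i)^'.-nat k)) => rk /=; last by rewrite big1.
  rewrite -big_mkcond /= (eq_bigl (fun t => t == (n %/ k)%N)); last by move=> t; rewrite eq_sym.
  rewrite big_nat1_eq mulr1 (mulnC d k) divnMA eqn_leq -(ltnS _ i).
  by rewrite (ltn_divLR _ _ d0) (leq_divRL _ _ d0) andbC.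
rewrite [RHS]big_nat_cond (eq_bigl (fun m => (1 <= m < n.+1)%N && ((d %| m)%N &&
  ((upto i)^'.-nat (m %/ d)%N && (n %/ m == i)%N)))); last first.
  move=> m; case: (boolP (1 <= m < n.+1)%N) => //= /andP[m0 _].
  by rewrite -smooth_rough_uniq // andbC andbA.
rewrite -big_nat_cond.
transitivity (\sum_(1 <= m < n.+1 | (d %| m)%N &&
    ((upto i)^'.-nat (m %/ d)%N && (n %/ m == i)%N)) g d (n %/ (m %/ d))); last first.
  apply: congr_big_nat => // m /andP[/andP[dm /andP[rm _]] /andP[m0 _]].
  have := smooth_rough_uniq m0 sd; rewrite dm rm => /esym/eqP e.
  by rewrite -{1}(parts_mul i m0) e mulKn.
rewrite big_multiples //.
transitivity (\sum_(1 <= k < (n %/ d).+1 |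
    (upto i)^'.-nat k && (n %/ (d * k) == i)%N) g d (n %/ k)); last first.
  by apply: congr_big_nat => // k _; rewrite mulKn.
(* For k > n / d the quotient n / (d k) is 0, hence not i. *)
rewrite [LHS](@big_cat_nat _ _ _ (n %/ d).+1) //=; last by rewrite ltnS leq_div.
rewrite [X in _ + X]big_nat_cond [X in _ + X]big_pred0 ?addr0; last first.
  move=> k; apply/negP => /andP[/andP[h1 h2] /andP[_ /eqP h3]].
  move: h1; rewrite ltn_divLR // mulnC => /divn_small.
  by rewrite h3 => e; rewrite e in i0.
by [].
Qed.

Lemma local_sum_good I D n :
  \sum_(1 <= m < n.+1 | (n %/ m < I)%N && (smooth_part (n %/ m) m <= D)%N)
    g (smooth_part (n %/ m) m) (n %/ rough_part (n %/ m) m) = Apart I D n.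
Proof.
pose F i d m := g d (n %/ rough_part i m).
transitivity (\sum_(1 <= m < n.+1) \sum_(1 <= i < I)
   \sum_(1 <= d < D.+1 | (upto i).-nat d)
     if (n %/ m == i)%N && (smooth_part i m == d) then F i d m else 0).
  rewrite big_mkcond !big_nat; apply: eq_bigr => m /andP[m0 mn].
  have i0 : (0 < n %/ m)%N by rewrite divn_gt0.
  transitivity (\sum_(1 <= i < I | i == (n %/ m)%N)
      \sum_(1 <= d < D.+1 | (upto i).-nat d && (d == smooth_part i m)) F i d m); last first.
    rewrite big_mkcond; apply: eq_bigr => i _; rewrite eq_sym; case: eqP => e /=; last by rewrite big1.
    by rewrite -big_mkcondr; apply: eq_bigl => d; rewrite [d == _]eq_sym.
  rewrite big_nat1_eq i0 /=; case: ifP => [/andP[-> h]|].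
    by rewrite big_nat1_cond_eq smooth_part_gt0 ltnS h smooth_part_nat.
  case: ifP => // _ /= h; rewrite big_nat1_cond_eq ltnS h andbF //.
rewrite exchange_big_nat /Apart !big_nat; apply: eq_bigr => i /andP[i0 _].
rewrite exchange_big_nat; apply: eq_bigr => d sd.
by rewrite sum_rough_fiber // -big_mkcond.
Qed.

Definition bad I D n : nat := (\sum_(1 <= m < n.+1 |
  (n %/ m < I) && (D < smooth_part (n %/ m) m)) 1)%N.

Lemma sum_far I n : (0 < I)%N -> (\sum_(1 <= m < n.+1 | I <= n %/ m) 1 <= n %/ I)%N.
Proof.
move=> I0; rewrite -[leqRHS]muln1 -[(n %/ I)%N](subn1 (n %/ I).+1) -sum_nat_const_nat.
rewrite [leqRHS](@big_nat_widen _ _ _ _ _ n.+1) ?ltnS ?leq_div //=.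
rewrite big_nat_cond [leqRHS]big_nat_cond (eq_bigl (fun m => (0 < m < n.+1)%N && (m < (n %/ I).+1)%N)) //.
move=> m; case: (boolP (1 <= m < n.+1)%N) => //= /andP[m0 _].
by rewrite leq_divRL // ltnS leq_divRL // mulnC.
Qed.

Lemma local_sum_approx I D n : (0 < I)%N ->
  `|local_sum n - Apart I D n| <= n%:R / I%:R + (bad I D n)%:R.
Proof.
move=> I0; rewrite /local_sum -local_sum_good.
pose F m := g (smooth_part (n %/ m) m) (n %/ rough_part (n %/ m) m).
change (`|\sum_(1 <= m < n.+1) F m - \sum_(1 <= m < n.+1 |
  (n %/ m < I)%N && (smooth_part (n %/ m) m <= D)%N) F m| <= n%:R / I%:R + (bad I D n)%:R).
rewrite (bigID (fun m => (n %/ m < I)%N && (smooth_part (n %/ m) m <= D)%N)) /=.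
rewrite addrAC subrr add0r (bigID (fun m => (I <= n %/ m)%N)) /=.
have le_count (P : pred nat) : `|\sum_(1 <= m < n.+1 | P m) F m| <=
    (\sum_(1 <= m < n.+1 | P m) 1)%:R.
  by rewrite natr_sum; apply: (le_trans (ler_norm_sum _ _ _)); apply: ler_sum => m _; exact: g_le1.
apply: (le_trans (ler_normD _ _)); apply: lerD.
  apply: le_trans (le_count _) _.
  apply: (@le_trans _ _ (n %/ I)%:R); last by have /andP[] := divn_real R n I0.
  rewrite ler_nat; apply: leq_trans (sum_far n I0).
  by rewrite big_mkcond [leqRHS]big_mkcond; apply: leq_sum => m _; case: ifP => // /andP[_ ->].
apply: le_trans (le_count _) _; rewrite ler_nat /bad.
rewrite big_mkcond [leqRHS]big_mkcond; apply: leq_sum => m _.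
by rewrite -ltnNge [(D < _)%N]ltnNge; case: (n %/ m < I)%N; case: (_ <= D)%N.
Qed.

(** A union bound: if n / m lies in [2 ^ j, 2 ^ (j + 1)), then m is at most n / 2 ^ j and is a
    multiple of its smooth part, a 2 ^ (j + 1)-smooth d > D. *)
Lemma bad_le J D n : (bad (2 ^ J) D n <=
  \sum_(0 <= j < J) \sum_(D.+1 <= d < n.+1 | (upto (2 ^ j.+1)).-nat d)
    (n %/ 2 ^ j) %/ d)%N.
Proof.
apply: (@leq_trans (\sum_(1 <= m < n.+1) \sum_(0 <= j < J)
  \sum_(D.+1 <= d < n.+1 | (upto (2 ^ j.+1)).-nat d)
    ((d %| m) && (m < (n %/ 2 ^ j).+1)))).
  rewrite /bad big_mkcond !big_nat; apply: leq_sum => m /andP[m0 mn].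
  case: ifP => // /andP[h1 h2].
  have i0 : (0 < n %/ m)%N by rewrite divn_gt0.
  have /andP[l1 l2] := trunc_log_bounds (isT : 1 < 2)%N i0.
  set j := trunc_log 2 (n %/ m) in l1 l2.
  have jJ : (0 <= j < J)%N by rewrite -(@ltn_exp2l 2) // (leq_ltn_trans l1).
  set d := smooth_part (n %/ m) m in h2.
  have sd : (upto (n %/ m)).-nat d by apply: smooth_part_nat.
  have dm : (d %| m)%N by apply: dvdn_part.
  rewrite (bigD1_seq j) /= ?mem_index_iota ?iota_uniq //.
  rewrite -big_filter (bigD1_seq d) /= ?filter_uniq ?iota_uniq //; last first.
    rewrite mem_filter mem_index_iota h2 ltnS (leq_trans (dvdn_leq m0 dm)) // andbT.
    by rewrite andbT; apply: sub_in_pnat sd => p _; apply: leq_upto; apply: ltnW.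
  by rewrite dm ltnS leq_divRL ?expn_gt0 // mulnC -leq_divRL // l1.
rewrite exchange_big_nat; apply: leq_sum => j _.
rewrite exchange_big_nat big_nat_cond [leqRHS]big_nat_cond; apply: leq_sum => d /andP[/andP[d0 _] _].
have {}d0 : (0 < d)%N by lia.
rewrite -[leqRHS]muln1 -[X in (X * 1)%N](subn1 (_ %/ d).+1) -sum_nat_const_nat.
rewrite -(@big_multiples _ _ addn d (n %/ 2 ^ j) predT (fun=> 1%N)) //.
rewrite [leqRHS](@big_nat_widen _ _ _ _ _ n.+1) ?ltnS ?leq_div //= [leqRHS]big_mkcond /=.
by apply: leq_sum => m _; rewrite andbT; case: (_ && _).
Qed.

Lemma sum_inv_tt1 i d : (0 < i)%N -> (0 < d)%N ->
  \sum_((i * d)%N <= t < (i.+1 * d)%N) ((t * t.+1)%:R)^-1 =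
    ((i * i.+1)%:R)^-1 / d%:R :> R.
Proof.
move=> i0 d0.
rewrite (@eq_big_nat _ _ _ _ _ _ (fun t => - (t.+1%:R)^-1 - - (t%:R)^-1)); last first.
  move=> t /andP[ht _]; have t0 : t%:R != 0 :> R by rewrite pnatr_eq0; nia.
  have t1 : t%:R + 1 != 0 :> R by rewrite natr1 pnatr_eq0.
  by rewrite natrM -natr1; field; rewrite t0 t1.
rewrite telescope_sumr ?leq_mul //.
have ? : i%:R != 0 :> R by rewrite pnatr_eq0; lia.
have ? : i%:R + 1 != 0 :> R by rewrite natr1 pnatr_eq0.
have ? : d%:R != 0 :> R by rewrite pnatr_eq0; lia.
by rewrite !natrM -natr1; field; apply/and3P.
Qed.

Lemma abs_term_le i d : (0 < i)%N -> (0 < d)%N ->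
  \sum_((i * d)%N <= t < (i.+1 * d)%N) `|g d t / (t * t.+1)%N%:R| <=
    ((i * i.+1)%:R)^-1 / d%:R.
Proof.
move=> i0 d0; rewrite -sum_inv_tt1 //; apply: ler_sum => t _.
by rewrite normrM normfV normr_nat ler_piMl // invr_ge0 ler0n.
Qed.

Lemma term_le i d : (0 < i)%N -> (0 < d)%N ->
  `|term i d| <= ((i * i.+1)%:R)^-1 / d%:R.
Proof.
move=> i0 d0; apply: le_trans (abs_term_le i0 d0).
exact: ler_norm_sum.
Qed.

Lemma Apart_approx I D n : `|Apart I D n - n%:R * Cpart I D| <=
  \sum_(1 <= i < I) \sum_(1 <= d < D.+1 | (upto i).-nat d)
    \sum_((i * d)%N <= t < (i.+1 * d)%N)
      `|(rough_count i n t)%:R - euler_factor R i * (n%:R / (t * t.+1)%:R)|.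
Proof.
rewrite /Apart /Cpart mulr_sumr -sumrB.
apply: (le_trans (ler_norm_sum _ _ _)); apply: ler_sum => i _.
rewrite mulrA mulr_sumr -sumrB.
apply: (le_trans (ler_norm_sum _ _ _)); apply: ler_sum => d _.
rewrite mulr_sumr -sumrB.
apply: (le_trans (ler_norm_sum _ _ _)); apply: ler_sum => t _.
set a := (rough_count _ _ _)%:R; set w := euler_factor R i.
have -> : g d t * a - n%:R * w * (g d t / (t * t.+1)%:R) =
  g d t * (a - w * (n%:R / (t * t.+1)%:R)) by ring.
by rewrite normrM ler_piMl.
Qed.

Definition inv_nat (d : nat) : R := (d%:R)^-1.

(** The Euler factor is the inverse of the Euler product of the sum of 1 / d over all i-smooth d. So
    the i-th term of the series for C is at most 1 / (i (i + 1)), which is what makes it converge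
    absolutely. *)
Lemma euler_inv_smooth i N : euler_factor R i *
  \sum_(1 <= d < N.+1 | (upto i).-nat d) (d%:R)^-1 <= 1.
Proof.
have /andP[w0 _] := euler_factor_itv R i.
rewrite mulrC -ler_pdivlMr // mul1r.
apply: le_trans (@smooth_sum_le_prod R inv_nat _ _ _ _ i N) _.
- by move=> d; rewrite invr_ge0 ler0n.
- by rewrite /inv_nat invr1.
- by move=> a b _ _; rewrite /inv_nat natrM invfM.
- by move=> p pp; rewrite /inv_nat invf_lt1 ?ltr0n ?ltr1n ?prime_gt1 ?prime_gt0.
rewrite /euler_factor -prodfV le_eqVlt; apply/orP; left; apply/eqP.
apply: eq_bigr => p pp; congr (_^-1); rewrite mulrBl divff ?mul1r // pnatr_eq0.
by case: p pp.
Qed.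

Lemma sum_inv_ii1 I I' : (0 < I)%N -> (I <= I')%N ->
  \sum_(I <= i < I') ((i * i.+1)%:R)^-1 <= (I%:R)^-1 :> R.
Proof.
move=> I0 II.
rewrite (@eq_big_nat _ _ _ _ _ _ (fun t => - (t.+1%:R)^-1 - - (t%:R)^-1)); last first.
  move=> t /andP[ht _]; have t0 : t%:R != 0 :> R by rewrite pnatr_eq0; lia.
  have t1 : t%:R + 1 != 0 :> R by rewrite natr1 pnatr_eq0.
  by rewrite natrM -natr1; field; rewrite t0 t1.
by rewrite telescope_sumr // opprK gerDr oppr_le0 invr_ge0 ler0n.
Qed.

(** The indices i >= I cost at most the sum of 1 / (i (i + 1)), by [euler_inv_smooth]; for i < I
    only the d > D differ, and there the Euler factor is bounded by 1. *)
Lemma Cpart_tail I D I' N : (0 < I)%N -> (I <= I')%N -> (D <= N)%N ->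
  `|Cpart I' N - Cpart I D| <= (I%:R)^-1 +
    \sum_(1 <= i < I) ((i * i.+1)%:R)^-1 *
       \sum_(D.+1 <= d < N.+1 | (upto i).-nat d) (d%:R)^-1.
Proof.
move=> I0 II DN; rewrite /Cpart (@big_cat_nat _ _ _ I 1%N I') //=.
rewrite addrAC addrC -sumrB; apply: (le_trans (ler_normD _ _)); apply: lerD.
  apply: le_trans (sum_inv_ii1 I0 II).
  apply: (le_trans (ler_norm_sum _ _ _)); rewrite !big_nat; apply: ler_sum => i /andP[Ii _].
  have i0 : (0 < i)%N by lia.
  have /andP[w0 _] := euler_factor_itv R i.
  rewrite normrM (gtr0_norm w0).
  apply: (@le_trans _ _ (euler_factor R i * (((i * i.+1)%:R)^-1 *
     \sum_(1 <= d < N.+1 | (upto i).-nat d) (d%:R)^-1))); last first.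
    by rewrite mulrCA ler_piMr ?invr_ge0 ?ler0n // euler_inv_smooth.
  rewrite ler_pM2l // mulr_sumr; apply: (le_trans (ler_norm_sum _ _ _)).
  rewrite big_nat_cond [leRHS]big_nat_cond; apply: ler_sum => d /andP[/andP[d0 _] _].
  exact: term_le.
apply: (le_trans (ler_norm_sum _ _ _)); rewrite !big_nat; apply: ler_sum => i /andP[i0 _].
rewrite -mulrBr (@big_cat_nat _ _ _ D.+1 1%N N.+1) //= addrAC subrr add0r normrM.
have /andP[w0 w1] := euler_factor_itv R i.
rewrite (gtr0_norm w0); apply: (@le_trans _ _ (1 * `|\sum_(D.+1 <= d < N.+1 | (upto i).-nat d) term i d|)).
  by rewrite ler_wpM2r.
rewrite mul1r mulr_sumr; apply: (le_trans (ler_norm_sum _ _ _)).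
rewrite big_nat_cond [leRHS]big_nat_cond; apply: ler_sum => d /andP[/andP[d0 _] _].
by apply: term_le => //; lia.
Qed.

Lemma sum_dyadic (F : nat -> R) J : \sum_(1 <= i < 2 ^ J) F i =
  \sum_(0 <= j < J) \sum_((2 ^ j)%N <= i < (2 ^ j.+1)%N) F i.
Proof.
elim: J => [|J IH]; first by rewrite !big_geq.
rewrite big_nat_recr //= -IH (@big_cat_nat _ _ _ (2 ^ J)%N) //= ?expn_gt0 //.
by rewrite leq_exp2l.
Qed.

End Regrouping.

(** * Rankin's trick and the choice of the sieve level *)

Section Rankin.
Variable R : realType.

(* d ^ (s - 1), and 0 at d = 0. *)
Definition weight (s : R) (d : nat) : R :=
  if d is 0%N then 0 else expR ((s - 1) * ln d%:R).

Lemma weightE s d : (0 < d)%N -> weight s d = expR ((s - 1) * ln d%:R).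
Proof. by case: d. Qed.

Lemma weight_ge0 s d : 0 <= weight s d.
Proof. by case: d => // d; apply: expR_ge0. Qed.

Lemma weight1 s : weight s 1 = 1.
Proof. by rewrite /weight ln1 mulr0 expR0. Qed.

Lemma weightM s a b : (0 < a)%N -> (0 < b)%N ->
  weight s (a * b) = weight s a * weight s b.
Proof.
move=> a0 b0; rewrite !weightE ?muln_gt0 ?a0 // natrM lnM ?posrE ?ltr0n //.
by rewrite mulrDr expRD.
Qed.

Lemma inv_natE d : (0 < d)%N -> (d%:R)^-1 = expR (- ln d%:R) :> R.
Proof. by move=> d0; rewrite expRN lnK // posrE ltr0n. Qed.

Lemma weight_prime s p : prime p -> s <= 2^-1 -> weight s p <= 3 / 4.
Proof.
move=> pp s2; have p2 : 2 <= p%:R :> R by rewrite ler_nat prime_gt1.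
rewrite weightE ?prime_gt0 //.
apply: (@le_trans _ _ (expR (- (2^-1 * ln 2)))).
  rewrite ler_expR -mulNr.
  have l2 : ln 2 <= ln p%:R :> R by rewrite ler_ln ?posrE //; lra.
  have l0 : 0 <= ln 2 :> R by apply: ln_ge0; lra.
  by nra.
have h34 : 0 <= 3 / 4 :> R by lra.
rewrite -(@ler_pXn2r _ 2) ?nnegrE ?expR_ge0 ?h34 //.
rewrite -expRM_natl -[(2%:R * _)]/(2 * - (2^-1 * ln 2)).
have -> : 2 * - (2^-1 * ln 2) = - ln 2 :> R by field.
rewrite expRN lnK ?posrE //; lra.
Qed.

(** In the Euler product p ^ (s - 1) <= Z ^ s / p. The 4 comes from 1 / (1 - w) <= 1 + 4 w, valid
    for 0 <= w <= 3/4, the range given by s <= 1/2. *)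
Lemma rankin_sum s Z N : (0 < Z)%N -> 0 <= s -> s <= 2^-1 ->
  smooth_sum (weight s) Z N <= expR (4 * expR (s * ln Z%:R) * psum R Z).
Proof.
move=> Z0 s0 s2; apply: le_trans (smooth_sum_le_prod _ _ _ _ Z N) _.
- exact: weight_ge0.
- exact: weight1.
- exact: weightM.
- by move=> p pp; apply: le_lt_trans (weight_prime pp s2) _; lra.
rewrite /psum mulr_sumr expR_sum big_nat_cond [leRHS]big_nat_cond.
apply: ler_prod => p /andP[/andP[p0 pZ] pp].
have w34 := weight_prime pp s2; have w0 := weight_ge0 s p.
rewrite invr_ge0 subr_ge0 (le_trans w34) /=; last by lra.
have wle : weight s p <= expR (s * ln Z%:R) / p%:R.
  rewrite weightE // inv_natE // -expRD ler_expR mulrBl mul1r lerD2r.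
  by rewrite ler_wpM2l // ler_ln ?posrE ?ltr0n ?ler_nat.
apply: (@le_trans _ _ (expR (4 * weight s p))); last by rewrite ler_expR -mulrA ler_wpM2l.
apply: le_trans (expR_ge1Dx _).
rewrite -[leLHS]mul1r ler_pdivrMr; last by lra.
by nra.
Qed.

(** For d >= T one has 1 / d <= T ^ (- s) d ^ (s - 1); the sum is then extended to all smooth d <=
    N. *)
Lemma rankin_tail s Z D N (T : R) : 0 <= s -> 0 < T ->
  (forall d, (D < d)%N -> T <= d%:R) ->
  \sum_(D.+1 <= d < N.+1 | (upto Z).-nat d) (d%:R)^-1 <=
  expR (- (s * ln T)) * smooth_sum (weight s) Z N.
Proof.
move=> s0 T0 DT; rewrite /smooth_sum.
have [DN|ND] := leqP D N; last first.
  rewrite big_geq ?(leqW ND) //.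
  by rewrite ?mulr_ge0 ?expR_ge0 ?sumr_ge0 // => d _; exact: weight_ge0.
rewrite (@big_cat_nat _ _ _ D.+1 1%N N.+1) //= mulrDr ler_wpDl //.
  by rewrite mulr_ge0 ?expR_ge0 ?sumr_ge0 // => d _; exact: weight_ge0.
rewrite mulr_sumr big_nat_cond [leRHS]big_nat_cond.
apply: ler_sum => d /andP[/andP[Dd _] _]; have d0 : (0 < d)%N by lia.
rewrite inv_natE // weightE // -expRD ler_expR mulrBl mul1r addrA lerDr addrC.
by rewrite subr_ge0 ler_wpM2l // ler_ln ?posrE ?ltr0n // DT.
Qed.

(** Since r ^ r / r! is at most exp r, the quotient x ^ r / r! is at most (e x / r) ^ r. *)
Lemma expn_div_fact_le1 (x : R) r : 0 <= x -> expR 1 * x <= r%:R ->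
  x ^+ r / r`!%:R <= 1.
Proof.
move=> x0 xr.
have f0 : 0 < r`!%:R :> R by rewrite ltr0n fact_gt0.
have h : r%:R ^+ r / r`!%:R <= expR r%:R :> R.
  case: {xr} r f0 => [|r] f0; first by rewrite expr0 fact0 divr1 expR0.
  apply: le_trans (@expR_ge1Dxn R r.+1%:R r (ler0n _ _)); lra.
rewrite -(@ler_pM2l _ (expR r%:R)) ?expR_gt0 // mulr1; apply: le_trans h.
rewrite -{1}[r%:R]mulr1 expRM_natl mulrA -exprMn ler_wpM2r ?invr_ge0 ?(ltW f0) //.
by rewrite lerXn2r ?nnegrE ?mulr_ge0 ?expR_ge0 ?ler0n.
Qed.

End Rankin.

(** * The sieve error for one pair (i, d) *)

Section Blocks.
Variables (R : realType) (n : nat) (eta v zeta S : R) (Z : nat).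
Let lam : R := ln n%:R.
(** The Rankin exponent, chosen so that Z ^ sg = exp v. *)
Let sg : R := v / zeta.
Let T : R := expR ((2^-1 - eta) * lam).
Hypotheses (n0 : (0 < n)%N) (Z0 : (0 < Z)%N) (zetaE : zeta = ln Z%:R)
  (zeta0 : 0 < zeta) (v0 : 0 <= v) (eta0 : 0 < eta) (eta2 : eta <= 2^-1)
  (sg_eta : sg <= eta) (psumS : psum R Z <= S)
  (cond : expR 1 * (S * expR v) + 3 <= eta * lam / zeta).

Let sg0 : 0 <= sg.
Proof. by rewrite divr_ge0 // ltW. Qed.

Let lnT : ln T = (2^-1 - eta) * lam.
Proof. by rewrite /T expRK. Qed.

Let S0 : 0 <= S.
Proof. exact: le_trans (psum_ge0 R Z) psumS. Qed.

(* With u = ln (n / d ^ 2) / ln Z, the level is r = floor ((1 - eta) u) - 2: small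
   enough for d Z ^ r to be negligible against n / (i ^ 2 d), large enough for
   S ^ r / r`! <= exp (- r v), since r >= e S exp v. *)
Lemma sieve_choice d : (0 < d)%N -> d%:R <= T ->
  exists r : nat,
    [/\ Z%:R ^+ r <= expR ((1 - eta) * (lam - 2 * ln d%:R) - 2 * zeta) &
        S ^+ r / r`!%:R <= expR (3 * v - sg * ((1 - eta) * (lam - 2 * ln d%:R)))].
Proof.
move=> d0 dT; set mu := lam - 2 * ln d%:R.
have ld : ln d%:R <= (2^-1 - eta) * lam.
  by rewrite -lnT ler_ln ?posrE ?ltr0n ?expR_gt0.
have mu_ge : 2 * eta * lam <= mu by rewrite /mu; lra.
have lam0 : 0 <= lam by rewrite ln_ge0 // ler1n.
set au := (1 - eta) * mu / zeta.
(* Because d <= T gives mu >= 2 eta lam, and 1 - eta >= 1/2. *)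
have au_ge : eta * lam / zeta <= au.
  rewrite ler_pM2r ?invr_gt0 //.
  have h : 0 <= mu by apply: le_trans mu_ge; rewrite !mulr_ge0 // ltW.
  have : 0 <= (2^-1 - eta) * mu by rewrite mulr_ge0 // subr_ge0.
  by lra.
have eSV : expR 1 * (S * expR v) + 3 <= au by apply: le_trans au_ge.
have eSV0 : 0 <= expR 1 * (S * expR v) by rewrite !mulr_ge0 ?expR_ge0.
have au0 : 0 <= au by lra.
have /andP[q1 q2] := truncn_itv au0.
set q := Num.truncn au in q1 q2.
have q3 : (2 <= q)%N.
  have : 3 < q.+1%:R :> R by lra.
  by rewrite ltr_nat ltnS => /ltnW.
have qr : (q - 2)%:R = q%:R - 2 :> R by rewrite natrB.
have q2' : au < q%:R + 1 by rewrite natr1.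
have ez : Z%:R = expR zeta :> R by rewrite zetaE lnK // posrE ltr0n.
have auz : au * zeta = (1 - eta) * mu by rewrite /au divfK // gt_eqF.
exists (q - 2)%N; split.
  rewrite ez -expRM_natl ler_expR qr -auz mulrBl; have := ler_wpM2r (ltW zeta0) q1.
  by lra.
have -> : S = (S * expR v) / expR v by rewrite mulfK // gt_eqF // expR_gt0.
rewrite exprMn exprVn -expRM_natl -expRN mulrAC.
apply: (@le_trans _ _ (1 * expR (- ((q - 2)%:R * v)))).
  rewrite ler_wpM2r ?expR_ge0 // expn_div_fact_le1 ?mulr_ge0 ?expR_ge0 //.
  by rewrite qr; lra.
(* r = floor au - 2 exceeds au - 3: hence the loss of 3 v. *)
rewrite mul1r ler_expR qr.
have -> : sg * ((1 - eta) * mu) = v * au.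
  by rewrite -auz /sg; field; rewrite gt_eqF.
have := ler_wpM2l v0 (ltW q2'); lra.
Qed.

(** The d values of t contribute d Z ^ r and about n / (i ^ 2 d) times S ^ r / r!. Each is brought
    below half of the right side, whose dependence on d is the Rankin weight, ready to be summed
    over smooth d. *)
Lemma sieve_block i d : (0 < i)%N -> (i < Z)%N -> (0 < d)%N -> d%:R <= T ->
  \sum_((i * d)%N <= t < (i.+1 * d)%N)
      `|(rough_count i n t)%:R - euler_factor R i * (n%:R / (t * t.+1)%:R)|
  <= n%:R / (i ^ 2)%:R * (2 * expR (3 * v)) * expR (- (sg * ln T)) * weight sg d.
Proof.
move=> i0 iZ d0 dT; have [r [hZ hS]] := sieve_choice d0 dT.
have iR : 0 < i%:R :> R by rewrite ltr0n.
have dR : 0 < d%:R :> R by rewrite ltr0n.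
have nR : 0 < n%:R :> R by rewrite ltr0n.
have en : n%:R = expR lam :> R by rewrite lnK // posrE.
have ed : d%:R = expR (ln d%:R) :> R by rewrite lnK // posrE.
have ld : ln d%:R <= (2^-1 - eta) * lam.
  by rewrite -lnT ler_ln ?posrE ?expR_gt0.
have lam0 : 0 <= lam by rewrite ln_ge0 // ler1n.
have mu_ge : 2 * eta * lam <= lam - 2 * ln d%:R by lra.
have mu0 : 0 <= lam - 2 * ln d%:R by apply: le_trans mu_ge; rewrite !mulr_ge0 // ltW.
apply: (@le_trans _ _ (\sum_((i * d)%N <= t < (i.+1 * d)%N)
    (Z%:R ^+ r + n%:R * (S ^+ r / r`!%:R) * ((t * t.+1)%:R)^-1))).
  rewrite !big_nat; apply: ler_sum => t /andP[ht _].
  have t0 : (0 < t)%N by apply: leq_trans ht; rewrite muln_gt0 i0.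
  have := @brun_sieve R i n 1 t r isT t0; rewrite divn1 divr1 => h.
  apply: le_trans h _; apply: lerD.
    by rewrite lerXn2r ?nnegrE ?ler0n // ler_nat.
  rewrite [leRHS]mulrAC ler_wpM2l ?divr_ge0 ?ler0n // ler_wpM2r ?invr_ge0 ?ler0n //.
  rewrite lerXn2r ?nnegrE ?psum_ge0 //.
  exact: le_trans (le_psum R (ltnW iZ)) psumS.
rewrite big_split /= -mulr_sumr sum_inv_tt1 // sumr_const_nat -mulnBl subSn // subnn mul1n.
set X := n%:R / (i ^ 2)%:R * expR (3 * v) * expR (- (sg * ln T)) * weight sg d.
suff [h1 h2] : Z%:R ^+ r *+ d <= X /\
    n%:R * (S ^+ r / r`!%:R) * (((i * i.+1)%:R)^-1 / d%:R) <= X.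
  apply: (le_trans (lerD h1 h2)); rewrite /X le_eqVlt; apply/orP; left; apply/eqP.
  ring.
have i2 : 0 < (i ^ 2)%:R :> R by rewrite ltr0n expn_gt0 i0.
split; rewrite /X weightE //.
  rewrite -[leLHS]mulr_natr.
  apply: (@le_trans _ _ (expR ((1 - eta) * (lam - 2 * ln d%:R) - 2 * zeta + ln d%:R))).
    by rewrite expRD -ed ler_wpM2r // ltW.
  apply: (@le_trans _ _ (expR (lam - 2 * zeta + 3 * v - sg * ln T + (sg - 1) * ln d%:R))).
    rewrite ler_expR lnT.
    (* The slack eta (lam - 2 ln d) left by the level pays for the Rankin weight, thanks to sg <=
       eta; the term - 2 zeta supplies Z ^ (-2) <= i ^ (-2). *)
    have h1 : sg * ((2^-1 - eta) * lam - ln d%:R) <= eta * (2^-1 * (lam - 2 * ln d%:R)).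
      apply: ler_pM => //; first by lra.
      have : 0 <= eta * lam by rewrite mulr_ge0 // ltW.
      by lra.
    have h2 : 0 <= eta * (lam - 2 * ln d%:R) by rewrite mulr_ge0 // ltW.
    move: v0 h1 h2; move: sg lam (ln d%:R) => a b c; lra.
  rewrite expRD [X in X * _ <= _]expRD [X in X * _ * _ <= _]expRD.
  rewrite !ler_wpM2r ?expR_ge0 // expRB -en ler_wpM2l ?(ltW nR) //.
  rewrite lef_pV2 ?posrE ?expR_gt0 //.
  have -> : expR (2 * zeta) = (Z ^ 2)%:R :> R.
    by rewrite natrX zetaE -[2]/(2%:R) expRM_natl lnK // posrE ltr0n.
  by rewrite ler_nat leq_exp2r // ltnW.
apply: (@le_trans _ _ (n%:R * expR (3 * v - sg * ((1 - eta) * (lam - 2 * ln d%:R))) *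
    (((i ^ 2)%:R)^-1 * expR (- ln d%:R)))).
  rewrite ler_pM // ?mulr_ge0 ?invr_ge0 ?divr_ge0 ?exprn_ge0 ?ler0n //.
    by rewrite ler_wpM2l // ltW.
  rewrite -inv_natE // ler_wpM2r ?invr_ge0 ?(ltW dR) //.
  by rewrite lef_pV2 ?posrE ?ltr0n ?muln_gt0 ?expn_gt0 ?i0 // ler_nat leq_mul2l leqnSn orbT.
rewrite [leLHS]mulrACA -!mulrA ler_wpM2l ?(ltW nR) // ler_wpM2l ?invr_ge0 ?(ltW i2) //.
rewrite -!expRD ler_expR lnT.
have : sg * ((2^-1 - eta) * lam - ln d%:R) <= sg * ((1 - eta) * (lam - 2 * ln d%:R)).
  rewrite ler_wpM2l //.
  have h1 : 0 <= (2^-1 - eta) * (lam - 2 * ln d%:R) by rewrite mulr_ge0 // subr_ge0.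
  have h2 : 0 <= eta * lam by rewrite mulr_ge0 // ltW.
  by move: h1 h2; move: lam (ln d%:R) => b c; lra.
rewrite !(mulrA v zeta^-1) -/sg.
by move: sg lam (ln d%:R) => a b c; lra.
Qed.

End Blocks.

Lemma sub_smooth_sum (R : realType) (F : nat -> R) i j a b : (i <= j)%N ->
  (forall d, 0 <= F d) ->
  \sum_(a <= d < b | (upto i).-nat d) F d <=
  \sum_(a <= d < b | (upto j).-nat d) F d.
Proof.
move=> ij F0; rewrite big_mkcond [leRHS]big_mkcond; apply: ler_sum => d _.
case: ifP => h; last by case: ifP.
by rewrite (sub_in_pnat _ h) // => p _; apply: leq_upto.
Qed.

(* The indices i are cut into dyadic blocks [2 ^ j, 2 ^ (j + 1)). In block j smoothness
   is measured by 2 ^ max (j + 1, w), where w keeps the Rankin exponent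
   v / zeta j below eta when j is small. *)
Section Total.
Variables (R : realType) (g : nat -> nat -> R).
Hypothesis g_le1 : forall d t, `|g d t| <= 1.
Variables (n J w : nat) (eta v S : R).
Let lam : R := ln n%:R.
Let T : R := expR ((2^-1 - eta) * lam).
Let D := Num.truncn T.
Let Z j := (2 ^ maxn j.+1 w)%N.
Let zeta j : R := ln (Z j)%:R.
(** T ^ (- s) times the Rankin bound, for s = v / zeta j. It controls the large smooth parts, the
    sieve error and the tail of the series alike. *)
Definition block_error j : R :=
  expR (- (v / zeta j * ((2^-1 - eta) * lam))) * expR (4 * expR v * S).
Hypotheses (n0 : (0 < n)%N) (v0 : 0 <= v) (eta0 : 0 < eta) (eta2 : eta <= 2^-1)
  (sg_eta : forall j, (j < J)%N -> v / zeta j <= eta)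
  (psumS : forall j, (j < J)%N -> psum R (Z j) <= S)
  (cond : forall j, (j < J)%N -> expR 1 * (S * expR v) + 3 <= eta * lam / zeta j).

Let Z0 j : (0 < Z j)%N. Proof. by rewrite expn_gt0. Qed.

Let zeta0 j : 0 < zeta j.
Proof.
apply: ln_gt0; rewrite ltr1n -[1%N]/(2 ^ 0)%N ltn_exp2l //.
by rewrite leq_max.
Qed.

Let sg0 j : 0 <= v / zeta j. Proof. by rewrite divr_ge0 // ltW. Qed.

Let jZ i j : (i < 2 ^ j.+1)%N -> (i < Z j)%N.
Proof. by move=> h; apply: leq_trans h _; rewrite leq_exp2l // leq_maxl. Qed.

Let T0 : 0 < T. Proof. exact: expR_gt0. Qed.

Let DT d : (D < d)%N -> T <= d%:R.
Proof.
move=> Dd; have /andP[_ h] := truncn_itv (ltW T0).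
by apply: (le_trans (ltW h)); rewrite ler_nat.
Qed.

Let TD d : (d <= D)%N -> d%:R <= T.
Proof.
move=> dD; have /andP[h _] := truncn_itv (ltW T0).
by apply: le_trans h; rewrite ler_nat.
Qed.

Lemma smooth_weight_le j N : (j < J)%N ->
  smooth_sum (weight (v / zeta j)) (Z j) N <= expR (4 * expR v * S).
Proof.
move=> jJ; apply: (le_trans (rankin_sum _ _ _ _)) => //.
  exact: le_trans (sg_eta jJ) eta2.
by rewrite -/(zeta j) divfK ?gt_eqF // ler_expR ler_wpM2l ?psumS // mulr_ge0 ?expR_ge0.
Qed.

Lemma smooth_tail_le j N : (j < J)%N ->
  \sum_(D.+1 <= d < N.+1 | (upto (Z j)).-nat d) (d%:R)^-1 <= block_error j.
Proof.
move=> jJ; apply: (le_trans (rankin_tail (Z j) N (sg0 j) T0 DT)).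
rewrite /block_error /T expRK; apply: ler_wpM2l; first exact: expR_ge0.
exact: smooth_weight_le.
Qed.

Lemma bad_block_le j : (j < J)%N ->
  (\sum_(D.+1 <= d < n.+1 | (upto (2 ^ j.+1)).-nat d) (n %/ 2 ^ j) %/ d)%N%:R
   <= n%:R / (2 ^ j)%:R * block_error j.
Proof.
move=> jJ; rewrite natr_sum.
apply: (@le_trans _ _ (n%:R / (2 ^ j)%:R *
    \sum_(D.+1 <= d < n.+1 | (upto (2 ^ j.+1)).-nat d) (d%:R)^-1)).
  rewrite mulr_sumr big_nat_cond [leRHS]big_nat_cond; apply: ler_sum => d.
  move=> /andP[/andP[Dd _] _]; have d0 : (0 < d)%N by apply: leq_ltn_trans Dd.
  have /andP[h1 _] := divn_real R (n %/ 2 ^ j) d0; apply: (le_trans h1).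
  rewrite ler_wpM2r ?invr_ge0 ?ler0n //.
  by have /andP[] := divn_real R n (d := (2 ^ j)%N) (expn_gt0 _ _).
apply: ler_wpM2l; first by rewrite divr_ge0 ?ler0n.
apply: le_trans (smooth_tail_le n jJ).
apply: sub_smooth_sum => [|d]; last by rewrite invr_ge0 ler0n.
by rewrite leq_exp2l // leq_maxl.
Qed.

Lemma tail_block_le j N : (j < J)%N ->
  \sum_((2 ^ j)%N <= i < (2 ^ j.+1)%N) ((i * i.+1)%:R)^-1 *
     \sum_(D.+1 <= d < N.+1 | (upto i).-nat d) (d%:R)^-1 <=
  ((2 ^ j)%:R)^-1 * block_error j.
Proof.
move=> jJ; apply: (@le_trans _ _
  (\sum_((2 ^ j)%N <= i < (2 ^ j.+1)%N) ((i * i.+1)%:R)^-1 * block_error j)).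
  rewrite !big_nat; apply: ler_sum => i /andP[_ ij].
  rewrite ler_wpM2l ?invr_ge0 ?ler0n //; apply: le_trans (smooth_tail_le N jJ).
  apply: sub_smooth_sum => [|d]; last by rewrite invr_ge0 ler0n.
  exact/ltnW/jZ.
rewrite -mulr_suml ler_wpM2r ?mulr_ge0 ?expR_ge0 //.
by apply: sum_inv_ii1; rewrite ?expn_gt0 // leq_exp2l.
Qed.

Lemma sum_inv_sqr_block j :
  \sum_((2 ^ j)%N <= i < (2 ^ j.+1)%N) ((i ^ 2)%:R)^-1 <= ((2 ^ j)%:R)^-1 :> R.
Proof.
have p0 : 0 < (2 ^ j)%:R :> R by rewrite ltr0n expn_gt0.
apply: (@le_trans _ _ (\sum_((2 ^ j)%N <= i < (2 ^ j.+1)%N) (((2 ^ j) ^ 2)%:R)^-1)).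
  rewrite !big_nat; apply: ler_sum => i /andP[ji _].
  rewrite lef_pV2 ?posrE ?ltr0n ?expn_gt0 ?(leq_trans _ ji) ?expn_gt0 //.
  by rewrite ler_nat leq_exp2r.
have e : (2 ^ j.+1 - 2 ^ j = 2 ^ j)%N by rewrite expnS mul2n -addnn addnK.
rewrite sumr_const_nat e -[leLHS]mulr_natr natrX.
by rewrite expr2 invfM -mulrA mulVf ?mulr1 // gt_eqF.
Qed.

Lemma sieve_block_sum j : (j < J)%N ->
  \sum_((2 ^ j)%N <= i < (2 ^ j.+1)%N) \sum_(1 <= d < D.+1 | (upto i).-nat d)
    \sum_((i * d)%N <= t < (i.+1 * d)%N)
      `|(rough_count i n t)%:R - euler_factor R i * (n%:R / (t * t.+1)%:R)|
  <= n%:R / (2 ^ j)%:R * (2 * expR (3 * v) * block_error j).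
Proof.
move=> jJ; apply: (@le_trans _ _ (\sum_((2 ^ j)%N <= i < (2 ^ j.+1)%N)
    ((i ^ 2)%:R)^-1 * (n%:R * (2 * expR (3 * v) * block_error j)))); last first.
  rewrite -mulr_suml [in leRHS](mulrC n%:R) -[leRHS]mulrA ler_wpM2r ?sum_inv_sqr_block //.
  by rewrite !mulr_ge0 ?expR_ge0.
rewrite !big_nat; apply: ler_sum => i /andP[ji ij].
have i0 : (0 < i)%N by apply: leq_trans ji; rewrite expn_gt0.
apply: (@le_trans _ _ (n%:R / (i ^ 2)%:R * (2 * expR (3 * v)) *
    expR (- (v / zeta j * ln T)) *
    \sum_(1 <= d < D.+1 | (upto i).-nat d) weight (v / zeta j) d)).
  rewrite mulr_sumr big_nat_cond [leRHS]big_nat_cond; apply: ler_sum => d.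
  move=> /andP[/andP[d0 dD] _].
  apply: (@sieve_block R n eta v (zeta j) S (Z j)) => //;
    [exact: sg_eta|exact: psumS|exact: cond|exact: jZ|exact: TD].
rewrite /block_error /T expRK [leRHS]mulrA [leRHS]mulrA [leRHS]mulrA [in leRHS](mulrC _ n%:R) -mulrA.
rewrite -!mulrA !ler_wpM2l ?invr_ge0 ?ler0n ?expR_ge0 //.
rewrite mulrA; apply: le_trans (smooth_weight_le D jJ).
apply: sub_smooth_sum => [|d]; last exact: weight_ge0.
exact/ltnW/jZ.
Qed.

(** n / 2 ^ J accounts for n / m >= 2 ^ J; in each block the summand 1 accounts for smooth parts
    above D and 2 exp (3 v) for the sieve. *)
Theorem local_sum_error : `|local_sum g n - n%:R * Cpart g (2 ^ J) D| <=
  n%:R / (2 ^ J)%:R +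
  \sum_(0 <= j < J) n%:R / (2 ^ j)%:R * ((1 + 2 * expR (3 * v)) * block_error j).
Proof.
have J0 : (0 < 2 ^ J)%N by rewrite expn_gt0.
have h1 := local_sum_approx g_le1 D n J0.
have h2 := Apart_approx g_le1 (2 ^ J) D n.
rewrite -(subrK (Apart g (2 ^ J) D n) (local_sum g n)) -addrA.
apply: (le_trans (ler_normD _ _)); apply: (le_trans (lerD h1 h2)).
rewrite -addrA lerD2l sum_dyadic.
have h3 : (bad (2 ^ J) D n)%:R <=
    \sum_(0 <= j < J) n%:R / (2 ^ j)%:R * block_error j.
  have := bad_le J D n; rewrite -(ler_nat R) natr_sum => h; apply: (le_trans h).
  by rewrite !big_nat; apply: ler_sum => j /andP[_ jJ]; apply: bad_block_le.
apply: (le_trans (lerD h3 (lexx _))); rewrite -big_split /=.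
rewrite !big_nat; apply: ler_sum => j /andP[_ jJ].
apply: (le_trans (lerD (lexx _) (sieve_block_sum jJ))).
by rewrite le_eqVlt; apply/orP; left; apply/eqP; ring.
Qed.

Theorem Cpart_error I' N : (2 ^ J <= I')%N -> (D <= N)%N ->
  `|Cpart g I' N - Cpart g (2 ^ J) D| <= ((2 ^ J)%:R)^-1 +
    \sum_(0 <= j < J) ((2 ^ j)%:R)^-1 * block_error j.
Proof.
move=> II DN; have J0 : (0 < 2 ^ J)%N by rewrite expn_gt0.
apply: (le_trans (Cpart_tail g_le1 J0 II DN)); rewrite lerD2l sum_dyadic.
by rewrite !big_nat; apply: ler_sum => j /andP[_ jJ]; apply: tail_block_le.
Qed.

End Total.

(** * The error term *)

Section Growth.
Variable R : realType.

Lemma sqr_le_expR (eta M : R) : 0 < eta -> 0 <= M ->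
  exists X : R, 1 <= X /\ forall x, X <= x -> M * x ^+ 2 <= expR (eta * x).
Proof.
move=> eta0 M0; exists (1 + 6 * M / eta ^+ 3); split.
  by rewrite lerDl divr_ge0 ?mulr_ge0 ?exprn_ge0 // ltW.
move=> x Xx; have e3 : 0 < eta ^+ 3 by rewrite exprn_gt0.
have h : 0 <= 6 * M / eta ^+ 3 by rewrite divr_ge0 ?mulr_ge0 // ltW.
have x0 : 0 <= x by lra.
have hx : M <= eta ^+ 3 * x / 6.
  have : 6 * M / eta ^+ 3 <= x by lra.
  by rewrite ler_pdivrMr // => h6; rewrite ler_pdivlMr //; lra.
have := @expR_ge1Dxn R (eta * x) 2 (mulr_ge0 (ltW eta0) x0).
rewrite -[3`!]/6%N; apply: le_trans.
apply: (@le_trans _ _ ((eta * x) ^+ 3 / 6)); last by rewrite lerDr.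
have -> : (eta * x) ^+ 3 / 6 = (eta ^+ 3 * x / 6) * x ^+ 2 by field.
by rewrite ler_wpM2r // exprn_ge0.
Qed.

(* For x = ln (ln n) this is sqrt (ln n * ln (ln n)). *)
Definition Lam (x : R) : R := Num.sqrt (expR x * x).

Lemma Lam_bounds x : 1 <= x ->
  (expR (x / 2) <= Lam x) && (Lam x <= x * expR (x / 2)).
Proof.
move=> x1; have x0 : 0 <= x by lra.
have e2 : expR (x / 2) ^+ 2 = expR x by rewrite -expRM_natl; congr expR; field.
have ex := expR_ge0 x.
apply/andP; split.
  rewrite -[leLHS](@ger0_norm R) ?expR_ge0 // -sqrtr_sqr e2 ler_wsqrtr //.
  by rewrite ler_peMr.
rewrite -[leRHS](@ger0_norm R) ?mulr_ge0 ?expR_ge0 // -sqrtr_sqr ler_wsqrtr //.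
rewrite exprMn e2 mulrC ler_wpM2r // expr2 ler_peMl //.
Qed.

(** Here x = ln (ln n). The second condition bounds the number of blocks and the logarithms in
    [psum_le], the third is the sieve condition for ln Z <= Lam + 1, and the fourth hides all lower
    order factors in eta Lam. All follow from exp (x / 2) = exp v exp (eta x), where exp (eta x)
    beats every multiple of x ^ 2. *)
Lemma growth (eta : R) : 0 < eta -> eta <= 2^-1 ->
  exists X : R, forall x, X <= x -> let v := (2^-1 - eta) * x in
  [/\ 1 <= x, 2 * Lam x + 2 <= expR x,
      expR 1 * ((3 + 2 * x) * expR v) + 3 <= eta * expR x / (Lam x + 1) &
      x + 3 * v + v / eta + 1 + 4 * expR v * (3 + 2 * x) <= eta * Lam x].
Proof.
move=> eta0 eta2.
(* [c3] uses 3 + 2 x <= 5 x and Lam + 1 <= 2 x exp (x / 2); in [c4], 25 = 1 + 3 + 1 + 20 counts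
   multiples of x exp v. *)
pose c3 := 2 * (5 * expR 1 + 3) / eta; pose c4 := (25 + eta^-1) / eta.
have c30 : 0 <= c3.
  by rewrite divr_ge0 ?(ltW eta0) // mulr_ge0 // addr_ge0 // mulr_ge0 ?expR_ge0.
have c40 : 0 <= c4.
  by rewrite divr_ge0 ?(ltW eta0) // addr_ge0 // invr_ge0 ltW.
have M0 : 0 <= 4 + c3 + c4 by lra.
have [X [X1 hX]] := sqr_le_expR eta0 M0.
exists X => x Xx v; have x1 : 1 <= x by lra.
have := hX x Xx.
have -> : (4 + c3 + c4) * x ^+ 2 = 4 * x ^+ 2 + c3 * x ^+ 2 + c4 * x ^+ 2 by ring.
have x2 : x <= x ^+ 2 by rewrite expr2 ler_peMl //; lra.
have x20 : 0 <= x ^+ 2 by lra.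
have a3 : 0 <= c3 * x ^+ 2 by rewrite mulr_ge0.
have a4 : 0 <= c4 * x ^+ 2 by rewrite mulr_ge0.
move=> hM.
have h4 : 4 * x <= expR (eta * x) by lra.
have hc3 : c3 * x ^+ 2 <= expR (eta * x) by lra.
have hc4 : c4 * x <= expR (eta * x).
  by have := ler_wpM2l c40 x2; lra.
have /andP[L1 L2] := Lam_bounds x1.
set E := expR (x / 2) in L1 L2.
have E1 : 1 <= E by rewrite -expR0 ler_expR divr_ge0 //; lra.
have EE : expR x = E * E by rewrite /E -expRD; congr expR; field.
have v0 : 0 <= v by rewrite /v mulr_ge0 //; lra.
have vx : v <= x by rewrite /v; nra.
have EV : E = expR v * expR (eta * x) by rewrite /E /v -expRD; congr expR; field.
have V1 : 1 <= expR v by rewrite -expR0 ler_expR.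
set V := expR v in EV V1 *; set y := expR (eta * x) in hM h4 hc3 hc4 EV.
have y1 : 1 <= y by lra.
split=> //.
- have yE : y <= E by rewrite EV ler_peMl //; lra.
  have : 4 * x * E <= E * E by rewrite ler_wpM2r //; lra.
  have : 1 <= x * E by rewrite -[1]mulr1 ler_pM.
  by rewrite EE; lra.
- have L0 : 0 < Lam x + 1 by lra.
  rewrite ler_pdivlMr //.
  have xE : 1 <= x * E by rewrite -[1]mulr1 ler_pM.
  apply: (@le_trans _ _ (((5 * expR 1 + 3) * (x * V)) * (2 * (x * E)))).
    apply: ler_pM; [|lra| |lra].
      by rewrite addr_ge0 // !mulr_ge0 ?expR_ge0 //; lra.
    have xV : 1 <= x * V by rewrite -[1]mulr1 ler_pM.
    have -> : (5 * expR 1 + 3) * (x * V) = 5 * expR 1 * (x * V) + 3 * (x * V) by ring.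
    rewrite lerD //; last by lra.
    rewrite (mulrC 5) -mulrA ler_wpM2l ?expR_ge0 //.
    rewrite mulrA ler_wpM2r //; lra.
  rewrite EE.
  have -> : (5 * expR 1 + 3) * (x * V) * (2 * (x * E)) = eta * (c3 * x ^+ 2 * (V * E)).
    by rewrite /c3; field; rewrite gt_eqF.
  rewrite ler_wpM2l ?(ltW eta0) // mulrA ler_wpM2r //; first lra.
  by rewrite [X in _ <= X]EV mulrC ler_wpM2l //; lra.
have xV : x <= x * V by rewrite ler_peMr //; lra.
have ve : v / eta <= eta^-1 * (x * V).
  by rewrite mulrC ler_wpM2l ?invr_ge0 ?(ltW eta0) //; lra.
have hV : 4 * V * (3 + 2 * x) <= 20 * (x * V).
  have : V * 1 <= V * x by rewrite ler_wpM2l //; lra.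
  by lra.
apply: (@le_trans _ _ ((25 + eta^-1) * (x * V))).
  have -> : (25 + eta^-1) * (x * V) = 25 * (x * V) + eta^-1 * (x * V) by ring.
  by lra.
have -> : (25 + eta^-1) * (x * V) = eta * (c4 * x * V).
  by rewrite /c4; field; rewrite gt_eqF.
rewrite ler_wpM2l ?(ltW eta0) //; apply: le_trans L1.
by rewrite EV mulrC ler_wpM2l //; lra.
Qed.

End Growth.

Section MainError.
Variables (R : realType) (g : nat -> nat -> R) (C : R).

(* C is the iterated limit of the partial sums Cpart g I' N: every bound valid
   for all large I' and N passes to C. *)
Definition is_Clim := forall (I0 D0 : nat) (c0 r : R),
  (forall I' N, (I0 <= I')%N -> (D0 <= N)%N -> `|Cpart g I' N - c0| <= r) ->
  `|C - c0| <= r.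
Lemma ln2_bounds : 2^-1 <= ln (2 : R) <= 1.
Proof.
have h : expR (2^-1) <= 2 :> R.
  have := expR_ge1Dx (- 2^-1 : R); rewrite expRN => h.
  have e0 := expR_gt0 (2^-1 : R).
  have : 2^-1 <= (expR (2^-1 : R))^-1 by lra.
  by rewrite lef_pV2 ?posrE.
apply/andP; split; first by rewrite -ler_expR lnK ?posrE.
by rewrite -ler_expR lnK ?posrE //; have := expR_ge1Dx (1 : R); lra.
Qed.

Lemma amgm (a z : R) : 0 < z -> 2 * a <= z + a ^+ 2 / z.
Proof.
move=> z0; rewrite -subr_ge0.
have -> : z + a ^+ 2 / z - 2 * a = (z - a) ^+ 2 / z by field; rewrite gt_eqF.
by rewrite divr_ge0 ?sqr_ge0 // ltW.
Qed.

End MainError.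

(** Of the loss 3 eta, 2 eta comes from minimizing over zeta and eta from the lower order factors.
    The constant is 10 = 2 + 8: the indices beyond 2 ^ J count in both [h1] and [h2], and the blocks
    together give 8. *)
Lemma main_error_at (R : realType) (g : nat -> nat -> R) (C eta : R) (n : nat) :
  (forall d t, `|g d t| <= 1) -> is_Clim g C -> 0 < eta -> eta <= 2^-1 ->
  (0 < n)%N -> let x := ln (ln n%:R) in let v := (2^-1 - eta) * x in
  0 < ln (n%:R : R) -> 1 <= x -> 2 * Lam x + 2 <= expR x ->
  expR 1 * ((3 + 2 * x) * expR v) + 3 <= eta * expR x / (Lam x + 1) ->
  x + 3 * v + v / eta + 1 + 4 * expR v * (3 + 2 * x) <= eta * Lam x ->
  `|local_sum g n - C * n%:R| <= 10 * (n%:R * expR (- (1 - 3 * eta) * Lam x)).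
Proof.
move=> g_le1 C_lim eta0 eta2 n0 x v lam0 x1 E2 E3 E4.
have /andP[l2a l2b] := ln2_bounds R; set l2 := ln (2 : R) in l2a l2b.
have l20 : 0 < l2 by move: l2a; clear; lra.
have elam : expR x = ln n%:R by rewrite /x lnK // posrE.
have v0 : 0 <= v by rewrite /v mulr_ge0 ?subr_ge0 //; move: x1; clear; lra.
have ve0 : 0 <= v / eta by rewrite divr_ge0 // ltW.
set L := Lam x in E2 E3 E4 *.
have L0 : 0 <= L by apply: sqrtr_ge0.
have V0 := expR_gt0 v; set V := expR v in V0 E3 E4.
pose S := 3 + 2 * x.
have VS0 : 0 <= 4 * V * S by rewrite !mulr_ge0 /S ?(ltW V0) //; move: x1; clear; lra.
have eL : eta * L <= 2^-1 * L by rewrite ler_wpM2r.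
have veL : v / eta <= L by rewrite -/S in E4; move: E4 eL VS0 v0 x1 L0; clear; lra.
have t1 : 0 <= v / eta / l2 by rewrite divr_ge0 // ltW.
have t2 : 0 <= L / l2 by rewrite divr_ge0 // ltW.
(* 2 ^ w >= exp (v / eta) keeps the Rankin exponents below eta; 2 ^ J >= exp L makes the indices
   beyond 2 ^ J negligible. *)
pose w := (Num.truncn (v / eta / l2)).+1; pose J := (Num.truncn (L / l2)).+1.
have /andP[w1 w2] := truncn_itv t1; have /andP[J1 J2] := truncn_itv t2.
rewrite -/w -/J in w2 J2.
have {}w1 : w%:R * l2 <= v / eta + l2.
  by move: w1; rewrite ler_pdivlMr // /w -natr1 mulrDl mul1r; clear; lra.
have {}J1 : J%:R * l2 <= L + l2.
  by move: J1; rewrite ler_pdivlMr // /J -natr1 mulrDl mul1r; clear; lra.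
have {}w2 : v / eta <= w%:R * l2 by move: w2; rewrite ltr_pdivrMr // => /ltW.
have {}J2 : L <= J%:R * l2 by move: J2; rewrite ltr_pdivrMr // => /ltW.
pose s j := maxn j.+1 w.
have zE j : ln ((2 ^ s j)%:R : R) = (s j)%:R * l2.
  by rewrite natrX lnXn // -[_ *+ s j]mulr_natl.
have s0 j : (0 < s j)%N by rewrite leq_max.
have z0 j : 0 < (s j)%:R * l2 by rewrite mulr_gt0 ?ltr0n.
have z1 j : v / eta <= (s j)%:R * l2.
  by apply: (le_trans w2); rewrite ler_wpM2r ?(ltW l20) // ler_nat leq_maxr.
have z2 j : (j < J)%N -> (s j)%:R * l2 <= L + 1.
  move=> jJ; apply: (@le_trans _ _ ((maxn J w)%:R * l2)).
    rewrite ler_wpM2r ?(ltW l20) // ler_nat geq_max leq_maxr andbT.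
    by rewrite leq_max jJ.
  by rewrite /maxn; case: ifP => _; move: w1 J1 veL l2b; clear; lra.
have z3 j : (s j)%:R * l2 <= j.+1%:R * l2 + v / eta + 1.
  have : (s j)%:R <= j.+1%:R + w%:R :> R by rewrite -natrD ler_nat geq_max leq_addr leq_addl.
  by move=> /(ler_wpM2r (ltW l20)); rewrite mulrDl; move: w1 l2b; clear; lra.
have c1 j : (j < J)%N -> v / ln (2 ^ maxn j.+1 w)%:R <= eta.
  move=> jJ; rewrite zE ler_pdivrMr // mulrC -ler_pdivrMr //.
have c2 j : (j < J)%N -> psum R (2 ^ maxn j.+1 w) <= S.
  move=> jJ; apply: (@le_trans _ _ (3 + 2 * ln (s j)%:R)).
    rewrite -[X in ln X%:R](prednK (s0 j)); apply: psum_le.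
    by rewrite leq_exp2l // (prednK (s0 j)) leqnSn.
  rewrite /S lerD2l ler_wpM2l // -ler_expR lnK ?posrE ?ltr0n //.
  apply: le_trans E2; have := z2 j jJ.
  have : 2^-1 * (s j)%:R <= (s j)%:R * l2 by rewrite mulrC ler_wpM2l ?ler0n.
  by clear; lra.
have c3 j : (j < J)%N -> expR 1 * (S * expR v) + 3 <= eta * ln n%:R / ln (2 ^ maxn j.+1 w)%:R.
  move=> jJ; apply: (le_trans E3); rewrite elam zE.
  rewrite ler_wpM2l ?mulr_ge0 ?(ltW eta0) ?(ltW lam0) //.
  by rewrite lef_pV2 ?posrE ?z2 //; move: L0; clear; lra.
set D := Num.truncn (expR ((2^-1 - eta) * ln (n%:R : R))).
have h1 := local_sum_error g_le1 n0 v0 eta0 eta2 c1 c2 c3.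
rewrite -/D in h1.
have h2 : `|C - Cpart g (2 ^ J) D| <= ((2 ^ J)%:R)^-1 +
    \sum_(0 <= j < J) ((2 ^ j)%:R)^-1 * block_error n w eta v S j.
  by apply: (C_lim (2 ^ J)%N D) => I' N hI hN; apply: Cpart_error.
set B := fun j => block_error n w eta v S j.
set c0 := Cpart g (2 ^ J) D in h1 h2.
have nR : 0 < n%:R :> R by rewrite ltr0n.
have p2 j : (2 ^ j)%:R = expR (j%:R * l2) :> R.
  by rewrite expRM_natl lnK ?posrE // natrX.
have hJ : ((2 ^ J)%:R)^-1 <= expR (- (1 - 3 * eta) * L).
  rewrite p2 -expRN ler_expR; have : 0 <= eta * L by rewrite mulr_ge0 // ltW.
  by move: J2; clear; lra.
(* 2 + 2 exp (3 v) is 1 + 2 exp (3 v) from [h1] plus 1 from [h2]. The factor exp (- x) pays for the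
   J <= exp x blocks. *)
have hB j : (j < J)%N -> ((2 ^ j)%:R)^-1 * ((2 + 2 * expR (3 * v)) * B j) <=
    8 * expR (- x - (1 - 3 * eta) * L).
  move=> jJ.
  (* The decay in j is rewritten through zeta = s j ln 2, the quantity in the block error, at the
     cost exp (v / eta + 1) of rounding j + 1 up to w. *)
  have e1 : ((2 ^ j)%:R)^-1 <= 2 * expR (v / eta + 1 - (s j)%:R * l2).
    have -> : ((2 ^ j)%:R)^-1 = 2 * expR (- (j.+1%:R * l2)) :> R.
      by rewrite expRN -p2 expnS natrM invfM mulrA divff ?mul1r // pnatr_eq0.
    by rewrite ler_pM2l // ler_expR; have := z3 j; clear; lra.
  have e3 : 2 + 2 * expR (3 * v) <= 4 * expR (3 * v).
    have : expR 0 <= expR (3 * v) by rewrite ler_expR mulr_ge0.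
    by rewrite expR0; clear; lra.
  have e3' : 0 <= 2 + 2 * expR (3 * v) by rewrite addr_ge0 // mulr_ge0 ?expR_ge0.
  have B0 : 0 <= B j by rewrite mulr_ge0 ?expR_ge0.
  apply: (@le_trans _ _ ((2 * expR (v / eta + 1 - (s j)%:R * l2)) * (4 * expR (3 * v) * B j))).
    by apply: ler_pM => //; [rewrite mulr_ge0|rewrite ler_wpM2r].
  rewrite (_ : _ * _ = 8 * (expR (v / eta + 1 - (s j)%:R * l2) *
    expR (3 * v) * B j)); last by ring.
  rewrite /B /block_error zE -/V ler_wpM2l // -!expRD ler_expR.
  (* the minimum over zeta of zeta + a ^ 2 / zeta is 2 a: this produces the
     exponent (1 - 2 eta) sqrt (ln n * ln (ln n)) *)
  have am := amgm ((2^-1 - eta) * L) (z0 j).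
  have L2 : L ^+ 2 = ln n%:R * x.
    by rewrite /L /Lam sqr_sqrtr -?elam // mulr_ge0 ?expR_ge0 //; move: x1; clear; lra.
  have e4 : ((2^-1 - eta) * L) ^+ 2 / ((s j)%:R * l2) =
     v / ((s j)%:R * l2) * ((2^-1 - eta) * ln n%:R).
    by rewrite exprMn L2 /v; field; rewrite !gt_eqF ?ltr0n.
  rewrite e4 in am; rewrite -/S in E4; move: am E4; clear; lra.
have tot : `|local_sum g n - C * n%:R| <= n%:R * (2 * ((2 ^ J)%:R)^-1 +
    \sum_(0 <= j < J) ((2 ^ j)%:R)^-1 * ((2 + 2 * expR (3 * v)) * B j)).
  have -> : local_sum g n - C * n%:R = (local_sum g n - n%:R * c0) - n%:R * (C - c0) by ring.
  apply: (le_trans (ler_normB _ _)); rewrite [X in _ + X]normrM [ `|n%:R| ]ger0_norm ?ler0n //.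
  apply: (le_trans (lerD h1 (ler_wpM2l (ltW nR) h2))).
  rewrite le_eqVlt; apply/orP; left; apply/eqP.
  rewrite !mulrDr !mulr_sumr addrACA -big_split /=; congr (_ + _); first by ring.
  by apply: eq_bigr => j _; rewrite /B; ring.
apply: (le_trans tot); rewrite [leRHS]mulrCA ler_wpM2l ?(ltW nR) //.
have -> : 10 * expR (- (1 - 3 * eta) * L) =
  2 * expR (- (1 - 3 * eta) * L) + 8 * expR (- (1 - 3 * eta) * L) by ring.
apply: lerD; first by rewrite ler_wpM2l.
apply: (@le_trans _ _ (\sum_(0 <= j < J) 8 * expR (- x - (1 - 3 * eta) * L))).
  by rewrite !big_nat; apply: ler_sum => j /andP[_ jJ]; apply: hB.
rewrite sumr_const_nat subn0 -[leLHS]mulr_natr expRD mulNr -!mulrA ler_wpM2l //.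
rewrite mulrCA ler_piMr ?expR_ge0 // expRN mulrC ler_pdivrMr ?expR_gt0 // mul1r.
apply: le_trans E2.
have : 2^-1 * J%:R <= J%:R * l2 by rewrite mulrC ler_wpM2l ?ler0n.
by move: J1 l2b; clear; lra.
Qed.

Section ErrorRate.
Local Open Scope classical_set_scope.
Local Open Scope ring_scope.

Theorem main_error (R : realType) (g : nat -> nat -> R) (C eps : R) :
  (forall d t, `|g d t| <= 1) -> is_Clim g C -> 0 < eps ->
  exists K : R, 0 <= K /\ \forall n \near \oo,
    `|local_sum g n - C * n%:R| <= K * error_term eps n.
Proof.
move=> g_le1 C_lim eps0; pose eta := Num.min (eps / 3) (2^-1).
have eta0 : 0 < eta by rewrite lt_min divr_gt0 //=; lra.
have eta2 : eta <= 2^-1 by rewrite ge_min lexx orbT.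
have eta3 : 3 * eta <= eps.
  have : eta <= eps / 3 by rewrite ge_min lexx.
  by lra.
have [X hX] := growth eta0 eta2.
exists 10; split => //.
near=> n.
have nA : expR (expR X) <= n%:R by near: n; apply: nbhs_infty_ger.
have n1 : 0 < n%:R :> R by apply: lt_le_trans nA; apply: expR_gt0.
have lX : expR X <= ln n%:R by rewrite -ler_expR lnK.
have l0 : 0 < ln n%:R :> R by apply: lt_le_trans lX; apply: expR_gt0.
have xX : X <= ln (ln n%:R) by rewrite -ler_expR lnK ?posrE.
have [x1 E2 E3 E4] := hX _ xX.
have n0 : (0 < n)%N by rewrite -(ltr0n R).
apply: (le_trans (main_error_at g_le1 C_lim eta0 eta2 n0 l0 x1 E2 E3 E4)).
rewrite ler_wpM2l // /error_term /Lam lnK ?posrE // ler_wpM2l ?(ltW n1) //.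
by rewrite ler_expR ler_wpM2r ?sqrtr_ge0 //; lra.
Unshelve. all: by end_near.
Qed.

End ErrorRate.

(** * Convergence of the defining series *)

Section Limits.
Local Open Scope classical_set_scope.
Local Open Scope ring_scope.
Variable R : realType.

Lemma lim_dist (u : nat -> R) (c r : R) n0 : cvgn u ->
  (forall n, (n0 <= n)%N -> `|u n - c| <= r) -> `|limn u - c| <= r.
Proof.
move=> cu h; rewrite ler_distl; apply/andP; split.
  apply: limr_ge => //; near=> n.
  have : (n0 <= n)%N by near: n; exists n0.
  by move=> /h; rewrite ler_distl => /andP[].
apply: limr_le => //; near=> n.
have : (n0 <= n)%N by near: n; exists n0.
by move=> /h; rewrite ler_distl => /andP[].
Unshelve. all: by end_near.
Qed.

Lemma abs_sum_cvg (u : nat -> R) (P : pred nat) m (M : R) :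
  (forall N, \sum_(m <= k < N | P k) `|u k| <= M) ->
  cvgn (fun N => \sum_(m <= k < N | P k) u k) /\
  `|limn (fun N => \sum_(m <= k < N | P k) u k)| <= M.
Proof.
move=> hM; set U := fun N => _.
have cU : cvgn U.
  (* [series] sums from 0 without a filter, so the missing terms are set to 0. *)
  pose v k := if (m <= k)%N && P k then u k else 0.
  have sE (F : nat -> R) (F0 : F = (fun k => if (m <= k)%N && P k then F k else 0)) N :
      \sum_(m <= k < N | P k) F k = \sum_(0 <= k < N) F k.
    have [mN|Nm] := leqP m N.
      rewrite [RHS](@big_cat_nat _ _ _ m) //= [X in _ = X + _]big_nat_cond [X in _ = X + _]big1 ?add0r.
        rewrite big_mkcond !big_nat; apply: eq_bigr => k /andP[mk _].
        by rewrite [in RHS]F0 mk.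
      by move=> k /andP[/andP[_ km] _]; rewrite F0 leqNgt km.
    rewrite big_geq ?(ltnW Nm) // big_nat_cond big1 // => k /andP[/andP[_ kN] _].
    by rewrite F0 leqNgt (ltn_trans kN Nm).
  have -> : U = series v.
    apply/funext => N; rewrite /U /series /= -sE; last first.
      by apply/funext => k; rewrite /v; case: ifP.
    rewrite big_nat_cond [RHS]big_nat_cond; apply: eq_bigr => k.
    by rewrite /v => /andP[/andP[-> _] ->].
  apply: normed_cvg; apply: nondecreasing_is_cvgn.
    apply/nondecreasing_seqP => n.
    change (\sum_(0 <= k < n) `|v k| <= \sum_(0 <= k < n.+1) `|v k|).
    by rewrite big_nat_recr //= lerDl.
  exists M => _ [N _ <-]; apply: le_trans (hM N).
  change (\sum_(0 <= k < N) `|v k| <= \sum_(m <= k < N | P k) `|u k|).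
  rewrite -sE; last by apply/funext => k; rewrite /v; case: ifP => // _; rewrite normr0.
  rewrite big_nat_cond [leRHS]big_nat_cond le_eqVlt; apply/orP; left; apply/eqP.
  by apply: eq_bigr => k; rewrite /v => /andP[/andP[-> _] ->].
split => //; have := @lim_dist U 0 M 0%N cU; rewrite subr0; apply => N _.
by rewrite subr0; apply: le_trans (hM N); apply: ler_norm_sum.
Qed.

Lemma cvg_big_sum (I : Type) (r : seq I) (P : pred I) (u : I -> nat -> R) (l : I -> R) :
  (forall i, P i -> u i n @[n --> \oo] --> l i) ->
  (\sum_(i <- r | P i) u i n) @[n --> \oo] --> \sum_(i <- r | P i) l i.
Proof.
move=> h; elim: r => [|i r IH].
  by under eq_fun do rewrite big_nil; rewrite big_nil; apply: cvg_cst.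
rewrite big_cons; under eq_fun do rewrite big_cons.
by case: ifP => // Pi; apply: cvgD => //; apply: h.
Qed.

Variables (Psi : {fset nat} -> R).
Hypothesis Psi_add : divisor_additive Psi.

Let g := gain Psi.
Let g_le1 d t : `|g d t| <= 1. Proof. exact: gain_le1. Qed.

Lemma sum_abs_term_le i N : (0 < i)%N ->
  \sum_(1 <= d < N | (max_pdiv d <= i)%N)
    \sum_((i * d)%N <= t < (i.+1 * d)%N) `|C_term Psi d t| <=
  ((i * i.+1)%:R)^-1 / euler_factor R i.
Proof.
move=> i0; have /andP[w0 _] := euler_factor_itv R i.
rewrite ler_pdivlMr // mulrC.
apply: (@le_trans _ _ (euler_factor R i * (((i * i.+1)%:R)^-1 *
    \sum_(1 <= d < N.-1.+1 | (upto i).-nat d) (d%:R)^-1))); last first.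
  by rewrite mulrCA ler_piMr ?invr_ge0 // euler_inv_smooth.
rewrite ler_wpM2l ?(ltW w0) //.
case: N => [|N]; first by rewrite big_geq // mulr_ge0 ?invr_ge0 // sumr_ge0.
rewrite /= mulr_sumr big_nat_cond (eq_bigl (fun d => (1 <= d < N.+1)%N && (upto i).-nat d)).
  rewrite [leRHS]big_nat_cond; apply: ler_sum => d /andP[/andP[d0 _] _].
  exact: (abs_term_le g_le1 i0 d0).
by move=> d; case: (boolP (1 <= d < _)%N) => //= /andP[d0 _]; rewrite smoothE.
Qed.

(** The i-th term is at most 1 / (i (i + 1)), so the whole sum is at most 1. *)
Lemma C_abs_cvg_gain : C_abs_cvg Psi.
Proof.
rewrite /C_abs_cvg.
have inner i : (0 < i)%N -> (\sum_(1 <= d <oo | (max_pdiv d <= i)%N)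
    (\sum_((i * d)%N <= t < (i.+1 * d)%N) `|C_term Psi d t|)%:E <=
    (((i * i.+1)%:R)^-1 / euler_factor R i)%:E)%E.
  move=> i0; apply: lime_le.
    by apply: is_cvg_nneseries => d _ _; rewrite lee_fin sumr_ge0.
  by apply: nearW => N; rewrite sumEFin lee_fin sum_abs_term_le.
apply: (@le_lt_trans _ _ 1%E); last exact: ltry.
have nn i : (0 <= (euler_factor R i)%:E *
      \sum_(1 <= d <oo | (max_pdiv d <= i)%N)
        (\sum_((i * d)%N <= t < (i.+1 * d)%N) `|C_term Psi d t|)%:E)%E.
  have /andP[w0 _] := euler_factor_itv R i.
  apply: mule_ge0; first by rewrite lee_fin ltW.
  by apply: nneseries_ge0 => d _ _; rewrite lee_fin sumr_ge0.
apply: lime_le; first by apply: is_cvg_nneseries => i _ _; apply: nn.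
apply: nearW => N.
apply: (@le_trans _ _ (\sum_(1 <= i < N) (((i * i.+1)%:R)^-1)%:E)%E).
  rewrite big_nat_cond [leRHS]big_nat_cond; apply: lee_sum => i /andP[/andP[i0 _] _].
  have /andP[w0 _] := euler_factor_itv R i.
  apply: (@le_trans _ _ ((euler_factor R i)%:E * (((i * i.+1)%:R)^-1 / euler_factor R i)%:E)%E).
    by apply: lee_wpmul2l; [rewrite lee_fin ltW | exact: inner].
  by rewrite -EFinM lee_fin mulrCA divff ?mulr1 // gt_eqF.
rewrite sumEFin lee_fin.
have [N0|N0] := posnP N; first by rewrite N0 big_geq.
by apply: (le_trans (sum_inv_ii1 R (I := 1) isT N0)); rewrite invr1.
Qed.

Let inner_lim i : R := \big[+%R/0]_(1 <= d <oo | (max_pdiv d <= i)%N)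
       \sum_((i * d)%N <= t < (i.+1 * d)%N) C_term Psi d t.

Lemma inner_cvg i : (0 < i)%N ->
  cvgn (fun N => \sum_(1 <= d < N | (max_pdiv d <= i)%N)
       \sum_((i * d)%N <= t < (i.+1 * d)%N) C_term Psi d t) /\
  `|inner_lim i| <= ((i * i.+1)%:R)^-1 / euler_factor R i.
Proof.
move=> i0; apply: abs_sum_cvg => N; apply: le_trans (sum_abs_term_le N i0).
by apply: ler_sum => d _; apply: ler_norm_sum.
Qed.

(** The bound passes to the limit twice: in N for fixed I', where only finitely many inner series
    occur, and then in I'. *)
Lemma C_is_Clim : is_Clim g (C_ Psi).
Proof.
move=> I0 D0 c0 r h.
have [cO _] : cvgn (fun I => \sum_(1 <= i < I) euler_factor R i * inner_lim i) /\
    `|limn (fun I => \sum_(1 <= i < I) euler_factor R i * inner_lim i)| <= 1.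
  apply: abs_sum_cvg => N.
  apply: (@le_trans _ _ (\sum_(1 <= i < N) ((i * i.+1)%:R)^-1)).
    rewrite !big_nat; apply: ler_sum => i /andP[i0 _].
    have /andP[w0 _] := euler_factor_itv R i.
    have [_ hi] := inner_cvg i0.
    rewrite normrM (gtr0_norm w0) mulrC -ler_pdivlMr //.
  have [N0|N0] := posnP N; first by rewrite N0 big_geq.
  by apply: (le_trans (sum_inv_ii1 R (I := 1) isT N0)); rewrite invr1.
apply: (@lim_dist _ c0 r I0 cO) => I' hI.
pose U N := \sum_(1 <= i < I') euler_factor R i *
  \sum_(1 <= d < N | (max_pdiv d <= i)%N)
       \sum_((i * d)%N <= t < (i.+1 * d)%N) C_term Psi d t.
have cU : U N @[N --> \oo] --> \sum_(1 <= i < I') euler_factor R i * inner_lim i.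
  rewrite /U big_nat_cond.
  under eq_fun do rewrite big_nat_cond.
  apply: cvg_big_sum => i /andP[/andP[i0 _] _].
  by apply: cvgM; [exact: cvg_cst | have [] := inner_cvg i0].
rewrite -(cvg_lim _ cU) //.
apply: (@lim_dist _ c0 r D0.+1); first exact: (cvgP _ cU).
move=> [//|N] hN; have := h I' N hI hN.
suff -> : U N.+1 = Cpart g I' N by [].
rewrite /U /Cpart !big_nat; apply: eq_bigr => i /andP[i0 _]; congr (_ * _).
rewrite big_nat_cond [RHS]big_nat_cond; apply: eq_bigl => d.
by case: (boolP (1 <= d < _)%N) => //= /andP[d0 _]; rewrite smoothE.
Qed.

Theorem Psi_asymptotics (eps : R) : 0 < eps ->
  exists K : R, 0 <= K /\ \forall n \near \oo,
    `|Psi (nat_interval 1 n) - C_ Psi * n%:R| <= K * error_term eps n.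
Proof.
move=> eps0; have [K [K0 h]] := main_error g_le1 C_is_Clim eps0.
exists K; split => //; near=> n.
have -> : Psi (nat_interval 1 n) = local_sum g n.
  rewrite (Psi_telescope Psi_add) /local_sum !big_nat.
  apply: eq_bigr => m /andP[m0 mn]; exact: gain_local.
by near: n.
Unshelve. all: by end_near.
Qed.

End Limits.

(** * Recursiveness of q_ and f_ *)

Section Recursion.
Local Open Scope nat_scope.

Lemma recursive_ext k (f g : k.-tuple nat -> nat) : f =1 g ->
  recursive f -> recursive g.
Proof. by move=> /funext ->. Qed.

Lemma recursive_const k c : recursive (fun _ : k.-tuple nat => c).
Proof.
elim: c => [|c IH]; first exact: rec_zero.
have := rec_comp rec_succ (fun _ : 'I_1 => IH).
by apply: recursive_ext => v; rewrite /thead tnth_mktuple.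
Qed.

Lemma recursive_comp1 k (u : nat -> nat) (f : k.-tuple nat -> nat) :
  recursive1 u -> recursive f -> recursive (fun v => u (f v)).
Proof.
move=> hu hf; have := rec_comp hu (fun _ : 'I_1 => hf).
by apply: recursive_ext => v; rewrite /thead tnth_mktuple.
Qed.

Definition recursive2 (op : nat -> nat -> nat) :=
  recursive (fun w : 2.-tuple nat => op (tnth w ord0) (tnth w ord_max)).

Lemma recursive_comp2 k (op : nat -> nat -> nat) (f g : k.-tuple nat -> nat) :
  recursive2 op -> recursive f -> recursive g ->
  recursive (fun v => op (f v) (g v)).
Proof.
move=> ho hf hg.
have h (i : 'I_2) : recursive (if i == ord0 then f else g) by case: ifP.
have := rec_comp ho h.
by apply: recursive_ext => v; rewrite !tnth_mktuple.
Qed.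

Lemma tnth_behead k (t : k.+1.-tuple nat) (i : 'I_k) :
  tnth [tuple of behead t] i = tnth t (lift ord0 i).
Proof. by rewrite [t in RHS]tuple_eta tnthS. Qed.

Lemma recursive_reindex k m (f : k.-tuple nat -> nat) (s : 'I_k -> 'I_m) :
  recursive f -> recursive (fun w : m.-tuple nat => f [tuple tnth w (s i) | i < k]).
Proof. by move=> hf; apply: (rec_comp hf (fun i => rec_proj (s i))). Qed.

Lemma recursive_weaken k (f : k.-tuple nat -> nat) : recursive f ->
  recursive (fun w : k.+1.-tuple nat => f [tuple of behead w]).
Proof.
move=> hf; have := recursive_reindex (fun i : 'I_k => lift ord0 i) hf.
apply: recursive_ext => w; congr f; apply: eq_from_tnth => i.
by rewrite tnth_mktuple tnth_behead.
Qed.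

Lemma recursive_head k : recursive (fun w : k.+1.-tuple nat => thead w).
Proof. exact: rec_proj. Qed.

Lemma recursive_subst k (F : k.+1.-tuple nat -> nat) (n : k.-tuple nat -> nat) :
  recursive F -> recursive n -> recursive (fun v => F [tuple of n v :: v]).
Proof.
move=> hF hn.
have h (i : 'I_k.+1) : recursive (fun v => tnth [tuple of n v :: v] i).
  case: (unliftP ord0 i) => [j|] ->.
    by apply: recursive_ext (rec_proj j) => v; rewrite tnthS.
  by apply: recursive_ext hn => v; rewrite tnth0.
have := rec_comp hF h; apply: recursive_ext => v; congr F.
by apply: eq_from_tnth => i; rewrite tnth_mktuple.
Qed.

(** [rec_prim] recurses on its first argument; substituting n v for it allows a computed number of
    iterations. *)
Lemma recursive_iter k (n b : k.-tuple nat -> nat) (H : nat -> nat -> k.-tuple nat -> nat) :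
  recursive n -> recursive b ->
  recursive (fun w : k.+2.-tuple nat =>
    H (thead w) (thead [tuple of behead w]) [tuple of behead [tuple of behead w]]) ->
  recursive (fun v => iteri (n v) (fun j r => H j r v) (b v)).
Proof.
move=> hn hb hH; have := recursive_subst (rec_prim hb hH) hn.
apply: recursive_ext => v.
have e : [tuple of behead [tuple of n v :: v]] = v by apply: val_inj.
rewrite e theadE; apply: eq_iteri => j r.
rewrite theadE; congr (H _ _ _); last by apply: val_inj.
Qed.

Lemma recursive2_iter (op : nat -> nat -> nat) (b : nat -> nat) (h : nat -> nat -> nat) :
  recursive1 b -> recursive2 h ->
  (forall x n, op x n = iteri n (fun _ r => h x r) (b x)) -> recursive2 op.
Proof.
move=> hb hh e; rewrite /recursive2.
apply: (@recursive_ext _ (fun w : 2.-tuple nat => iteri (tnth w ord_max)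
  (fun _ r => h (tnth w ord0) r) (b (tnth w ord0)))); first by move=> w; rewrite e.
apply: (recursive_iter (H := fun _ r w => h (tnth w ord0) r)); first exact: rec_proj.
  by apply: recursive_comp1 => //; apply: rec_proj.
apply: recursive_comp2 => //; last exact: recursive_weaken (recursive_head _).
exact: (recursive_weaken (recursive_weaken (recursive_head 1))).
Qed.

Lemma recursive1_succ : recursive1 succn.
Proof. exact: rec_succ. Qed.

Lemma recursive1_id : recursive1 id.
Proof. exact: recursive_head. Qed.

Lemma recursive1_const c : recursive1 (fun=> c).
Proof. exact: recursive_const. Qed.

Lemma recursive2_snd (u : nat -> nat) : recursive1 u -> recursive2 (fun _ y => u y).
Proof. by move=> hu; apply: recursive_comp1 => //; apply: rec_proj. Qed.

Lemma recursive2_addn : recursive2 addn.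
Proof.
apply: (recursive2_iter recursive1_id (recursive2_snd recursive1_succ)) => x n.
by elim: n => [|n IH]; rewrite ?addn0 // addnS IH.
Qed.

Lemma recursive2_muln : recursive2 muln.
Proof.
apply: (recursive2_iter (recursive1_const 0) recursive2_addn) => x n.
by elim: n => [|n IH]; rewrite ?muln0 // mulnS IH.
Qed.

Lemma recursive2_expn : recursive2 expn.
Proof.
apply: (recursive2_iter (recursive1_const 1) recursive2_muln) => x n.
by elim: n => [|n IH]; rewrite ?expn0 // expnS IH.
Qed.

Lemma recursive1_predn : recursive1 predn.
Proof.
(* The last counter value in an iteration of length n is n - 1. *)
apply: (@recursive_ext _ (fun v : 1.-tuple nat => iteri (thead v) (fun j _ => j) 0)).
  by move=> v; case: (thead v).
apply: (recursive_iter (H := fun j _ _ => j)); [exact: recursive_head|exact: rec_zero|].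
exact: recursive_head.
Qed.

Lemma recursive2_subn : recursive2 subn.
Proof.
apply: (recursive2_iter recursive1_id (recursive2_snd recursive1_predn)) => x n.
by elim: n => [|n IH]; rewrite ?subn0 // subnS IH.
Qed.

Lemma recursive2_leq : recursive2 (fun x y => x <= y : nat).
Proof.
apply: (@recursive_ext _ (fun w : 2.-tuple nat => 1 - (tnth w ord0 - tnth w ord_max))).
  by move=> w; rewrite -subn_eq0; case: (tnth w ord0 - tnth w ord_max) => [|m]; rewrite ?subn0 ?subSS ?sub0n.
apply: (recursive_comp2 recursive2_subn); first exact: recursive_const.
exact: recursive2_subn.
Qed.

Lemma recursive2_maxn : recursive2 maxn.
Proof.
apply: (@recursive_ext _ (fun w : 2.-tuple nat => tnth w ord0 + (tnth w ord_max - tnth w ord0))).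
  by move=> w; rewrite maxnE.
apply: (recursive_comp2 recursive2_addn); first exact: rec_proj.
by apply: (recursive_comp2 recursive2_subn); apply: rec_proj.
Qed.

Lemma recursive_big k (op : nat -> nat -> nat) (n : k.-tuple nat -> nat)
    (F : nat -> k.-tuple nat -> nat) :
  recursive2 op -> recursive n ->
  recursive (fun w : k.+1.-tuple nat => F (thead w) [tuple of behead w]) ->
  recursive (fun v => iteri (n v) (fun j r => op r (F j v)) 0).
Proof.
move=> ho hn hF; apply: (recursive_iter (H := fun j r v => op r (F j v))) => //.
  exact: rec_zero.
apply: (recursive_comp2 ho); first exact: recursive_weaken (recursive_head _).
pose s (i : 'I_k.+1) : 'I_k.+2 := lift (lift ord0 ord0) i.
have := recursive_reindex s hF; apply: recursive_ext => w.
have e : [tuple tnth w (s i) | i < k.+1] =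
    [tuple of thead w :: behead [tuple of behead w]].
  apply: eq_from_tnth => i; rewrite tnth_mktuple.
  case: (unliftP ord0 i) => [j|] ->.
    have -> : s (lift ord0 j) = lift ord0 (lift ord0 j) by apply: val_inj.
    by rewrite tnthS -!tnth_behead.
  have -> : s ord0 = ord0 by apply: val_inj.
  by rewrite !tnth0.
by rewrite e theadE; congr (F _ _); apply: val_inj.
Qed.

Lemma iteri_sum n (F : nat -> nat) :
  iteri n (fun j r => r + F j) 0 = \sum_(0 <= j < n) F j.
Proof. elim: n => [|n IH]; first by rewrite big_geq.
by rewrite big_nat_recr //= IH. Qed.

Lemma iteri_max n (F : nat -> nat) :
  iteri n (fun j r => maxn r (F j)) 0 = \max_(0 <= j < n) F j.
Proof. elim: n => [|n IH]; first by rewrite big_geq.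
by rewrite big_nat_recr //= IH. Qed.

Lemma recursive_sum k (n : k.-tuple nat -> nat) (F : nat -> k.-tuple nat -> nat) :
  recursive n ->
  recursive (fun w : k.+1.-tuple nat => F (thead w) [tuple of behead w]) ->
  recursive (fun v => \sum_(0 <= j < n v) F j v).
Proof.
move=> hn hF; have := recursive_big recursive2_addn hn hF.
by apply: recursive_ext => v; rewrite iteri_sum.
Qed.

Lemma recursive_bigmax k (n : k.-tuple nat -> nat) (F : nat -> k.-tuple nat -> nat) :
  recursive n ->
  recursive (fun w : k.+1.-tuple nat => F (thead w) [tuple of behead w]) ->
  recursive (fun v => \max_(0 <= j < n v) F j v).
Proof.
move=> hn hF; have := recursive_big recursive2_maxn hn hF.
by apply: recursive_ext => v; rewrite iteri_max.
Qed.

Lemma count_prefix m q : q <= m -> \sum_(0 <= j < m) (j < q : nat) = q.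
Proof.
move=> qm; rewrite (@big_cat_nat _ _ _ q) //= [X in _ + X]big_nat [X in _ + X]big1 ?addn0.
  rewrite big_nat (eq_bigr (fun=> 1)) -?big_nat ?sum_nat_const_nat ?subn0 ?muln1 //.
  by move=> j /andP[_ ->].
by move=> j /andP[qj _]; rewrite ltnNge qj.
Qed.

Lemma recursive2_divn2 : recursive2 (fun x y => x %/ 2 ^ y).
Proof.
apply: (@recursive_ext _ (fun w : 2.-tuple nat => \sum_(0 <= j < tnth w ord0)
    (j.+1 * 2 ^ tnth w ord_max <= tnth w ord0 : nat))).
  move=> w; rewrite -[RHS](count_prefix (leq_div (tnth w ord0) (2 ^ tnth w ord_max))).
  by apply: eq_bigr => j _; rewrite -leq_divRL ?expn_gt0.
apply: (recursive_sum (F := fun j w => (j.+1 * 2 ^ tnth w ord_max <= tnth w ord0 : nat))).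
  exact: rec_proj.
have w0 := recursive_weaken (rec_proj (ord0 : 'I_2)).
have w1 := recursive_weaken (rec_proj (ord_max : 'I_2)).
apply: (recursive_comp2 recursive2_leq) w0.
apply: (recursive_comp2 recursive2_muln).
  exact: recursive_comp1 recursive1_succ (recursive_head _).
exact: recursive_comp2 recursive2_expn (recursive_const _ _) w1.
Qed.

(** * Enumeration of the subsets of {1, ..., n} by binary digits *)

Section Counting.
Local Open Scope fset_scope.
Local Open Scope nat_scope.

Definition bit (j c : nat) : nat := c %/ 2 ^ j - 2 * (c %/ 2 ^ j.+1).

Lemma bitE j c : bit j c = odd (c %/ 2 ^ j).
Proof.
rewrite /bit expnSr divnMA divn2 -{1}[c %/ 2 ^ j]odd_double_half mul2n.
by rewrite addnK.
Qed.

Lemma sum_bits n c : c < 2 ^ n -> \sum_(0 <= j < n) odd (c %/ 2 ^ j) * 2 ^ j = c.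
Proof.
elim: n c => [|n IH] c; first by rewrite big_geq // expn0 ltnS leqn0 => /eqP->.
move=> hc; rewrite big_nat_recl // expn0 divn1 muln1.
rewrite (eq_bigr (fun j => 2 * (odd (c./2 %/ 2 ^ j) * 2 ^ j))); last first.
  by move=> j _; rewrite expnS divnMA divn2 mulnCA.
rewrite -big_distrr /= IH; first by rewrite mul2n odd_double_half.
by rewrite -divn2 ltn_divLR // mulnC -expnS.
Qed.

(** Digit b - 1 of c decides membership of b. As 0 is never an element, the canonical index of this
    set is 2 c. *)
Definition fset_of_bits (n c : nat) : {fset nat} :=
  [fset b in nat_interval 1 n | odd (c %/ 2 ^ b.-1)].

Lemma big_fset_of_bits n c (F : nat -> nat) :
  \sum_(b <- fset_of_bits n c) F b = \sum_(0 <= j < n) odd (c %/ 2 ^ j) * F j.+1.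
Proof.
transitivity (\sum_(1 <= b < n.+1 | odd (c %/ 2 ^ b.-1)) F b).
  rewrite -[RHS]big_filter; apply/perm_big/uniq_perm => //.
    exact/filter_uniq/iota_uniq.
  by move=> b; rewrite mem_filter mem_index_iota mem_interval_filter ltnS andbC.
rewrite big_mkcond big_add1 /=; apply: eq_bigr => j _.
by case: (odd _); rewrite ?mul1n ?mul0n.
Qed.

Lemma fset_code_bits n c : c < 2 ^ n -> fset_code (fset_of_bits n c) = 2 * c.
Proof.
move=> hc; rewrite /fset_code big_fset_of_bits -[in RHS](sum_bits hc) big_distrr.
by apply: eq_bigr => j _; rewrite /= expnS mulnCA.
Qed.

Lemma card_fset_of_bits n c : #|` fset_of_bits n c| = \sum_(0 <= j < n) bit j c.
Proof.
rewrite -sum1_size big_fset_of_bits; apply: eq_bigr => j _.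
by rewrite bitE muln1.
Qed.

Lemma card_nat_interval n : #|` nat_interval 1 n| = n.
Proof.
by rewrite /nat_interval card_fseq undup_id ?iota_uniq // size_iota subSS subn0.
Qed.

(** [fset_code] recovers c, so the 2 ^ n values are distinct subsets and exhaust the power set. *)
Lemma fpowerset_bits n : perm_eq (fpowerset (nat_interval 1 n))
  [seq fset_of_bits n c | c <- index_iota 0 (2 ^ n)].
Proof.
have inj : {in index_iota 0 (2 ^ n) &, injective (fset_of_bits n)}.
  move=> c c'; rewrite !mem_index_iota => /andP[_ hc] /andP[_ hc'] e.
  apply/eqP; rewrite -(eqn_pmul2l (isT : 0 < 2)).
  by rewrite -(fset_code_bits hc) -(fset_code_bits hc') e.
rewrite perm_sym; apply: uniq_perm.
- by rewrite map_inj_in_uniq ?iota_uniq.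
- exact: fset_uniq.
apply: (snd (uniq_min_size _ _ _)) => [|B /mapP[c _ ->]|].
- by rewrite map_inj_in_uniq ?iota_uniq.
- by rewrite fpowersetE; apply/fsubsetP => b; rewrite mem_interval_filter mem_nat_interval => /andP[].
by rewrite size_map size_iota subn0 card_fpowerset leq_exp2l // card_nat_interval.
Qed.

Variables (P : set {fset nat}) (chi : nat -> nat).
Hypothesis chiP : forall B : {fset nat}, 0 \notin B ->
  chi (fset_code B) = (B \in P : nat).

Lemma chi_bits n c : c < 2 ^ n -> chi (2 * c) = (fset_of_bits n c \in P).
Proof.
move=> hc; rewrite -(fset_code_bits hc) chiP //.
by rewrite mem_interval_filter.
Qed.

Lemma q_sum n : q_ P n = \sum_(0 <= c < 2 ^ n) chi (2 * c).
Proof.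
rewrite /q_ /Q -sum1_size.
transitivity (\sum_(B <- fpowerset (nat_interval 1 n) | B \in P) 1).
  rewrite -[RHS]big_filter; apply/perm_big/uniq_perm; rewrite ?fset_uniq ?filter_uniq //.
  by move=> B; rewrite mem_filter !inE andbC.
rewrite (perm_big _ (fpowerset_bits n)) big_map big_mkcond !big_nat /=.
by apply: eq_bigr => c hc; rewrite (chi_bits hc); case: (_ \in _).
Qed.

Lemma f_max n : f_ P n =
  \max_(0 <= c < 2 ^ n) (chi (2 * c) * \sum_(0 <= j < n) bit j c).
Proof.
rewrite /f_ /Phi (perm_big _ (fpowerset_bits n)) big_map big_mkcond !big_nat /=.
apply: eq_bigr => c hc; rewrite (chi_bits hc) card_fset_of_bits.
by case: (_ \in _); rewrite ?mul1n ?mul0n.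
Qed.

Hypothesis chi_rec : recursive1 chi.

Lemma recursive_chi2 k (c : k.-tuple nat -> nat) : recursive c ->
  recursive (fun v => chi (2 * c v)).
Proof.
move=> hc; apply: recursive_comp1 => //.
by apply: (recursive_comp2 recursive2_muln) hc; apply: recursive_const.
Qed.

Lemma recursive_exp2 k (c : k.-tuple nat -> nat) : recursive c ->
  recursive (fun v => 2 ^ c v).
Proof. by apply: (recursive_comp2 recursive2_expn); apply: recursive_const. Qed.

Lemma recursive_q : recursive1 (q_ P).
Proof.
apply: (@recursive_ext _ (fun v : 1.-tuple nat =>
  \sum_(0 <= c < 2 ^ thead v) chi (2 * c))); first by move=> v; rewrite q_sum.
apply: (recursive_sum (F := fun c _ => chi (2 * c))).
  exact/recursive_exp2/recursive_head.
exact/recursive_chi2/recursive_head.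
Qed.

Lemma recursive2_bit : recursive2 bit.
Proof.
apply: (recursive_comp2 recursive2_subn).
  by apply: (recursive_comp2 recursive2_divn2); apply: rec_proj.
apply: (recursive_comp2 recursive2_muln); first exact: recursive_const.
apply: (recursive_comp2 recursive2_divn2); first exact: rec_proj.
exact: recursive_comp1 recursive1_succ (rec_proj _).
Qed.

Lemma recursive_f : recursive1 (f_ P).
Proof.
apply: (@recursive_ext _ (fun v : 1.-tuple nat => \max_(0 <= c < 2 ^ thead v)
  (chi (2 * c) * \sum_(0 <= j < thead v) bit j c))); first by move=> v; rewrite f_max.
apply: (recursive_bigmax (F := fun c v =>
    (chi (2 * c) * \sum_(0 <= j < thead v) bit j c))).
  exact/recursive_exp2/recursive_head.
apply: (recursive_comp2 recursive2_muln); first exact/recursive_chi2/recursive_head.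
apply: (recursive_sum (F := fun j (w : 2.-tuple nat) => bit j (thead w))).
  exact: recursive_weaken (recursive_head _).
apply: (recursive_comp2 recursive2_bit); first exact: recursive_head.
exact: recursive_weaken (recursive_head _).
Qed.

End Counting.

End Recursion.

(** * Effective approximations *)

Section Rates.
Local Open Scope classical_set_scope.
Local Open Scope ring_scope.
Variable R : realType.

(** Once ln (ln n) >= 4, its square root is at least 2 and absorbs the factor 1 - 1/2 in the
    exponent. *)
Lemma mean_rate (a : nat -> R) (c K : R) : 0 <= K ->
  (\forall n \near \oo, `|a n - c * n%:R| <= K * error_term (2^-1) n) ->
  \forall n \near \oo, `|a n / n%:R - c| <= K * expR (- Num.sqrt (ln n%:R)).
Proof.
move=> K0 h; near=> n.
have nA : expR (expR 4) <= n%:R :> R by near: n; apply: nbhs_infty_ger.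
have n0 : 0 < n%:R :> R by apply: lt_le_trans nA; apply: expR_gt0.
have l4 : expR 4 <= ln n%:R :> R by rewrite -ler_expR lnK.
have l0 : 0 < ln n%:R :> R by apply: lt_le_trans l4; apply: expR_gt0.
have x4 : 4 <= ln (ln n%:R) :> R by rewrite -ler_expR lnK ?posrE.
have -> : a n / n%:R - c = (a n - c * n%:R) / n%:R.
  by rewrite mulrBl mulfK // gt_eqF.
rewrite normrM normfV [ `|n%:R| ]gtr0_norm // ler_pdivrMr //.
have hn : `|a n - c * n%:R| <= K * error_term (2^-1) n by near: n.
apply: (le_trans hn); rewrite -mulrA ler_wpM2l // /error_term mulrC.
rewrite ler_wpM2r ?(ltW n0) // ler_expR.
have s4 : 2 <= Num.sqrt (ln (ln n%:R)) :> R.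
  rewrite -[leLHS](@ger0_norm R) // -sqrtr_sqr ler_wsqrtr //.
  by apply: le_trans x4; rewrite expr2; lra.
rewrite sqrtrM ?(ltW l0) // mulNr lerN2.
have -> : 1 - 2^-1 = 2^-1 :> R by field.
rewrite mulrCA ler_peMr ?sqrtr_ge0 //; lra.
Unshelve. all: by end_near.
Qed.

Lemma expR_sqrt_ln_cvg0 :
  expR (- Num.sqrt (ln (n%:R : R))) @[n --> \oo] --> (0 : R).
Proof.
apply/cvgrPdist_le => e e0; near=> n.
have nA : expR (e^-1 ^+ 2) <= n%:R :> R by near: n; apply: nbhs_infty_ger.
have n0 : 0 < n%:R :> R by apply: lt_le_trans nA; apply: expR_gt0.
have le : e^-1 ^+ 2 <= ln n%:R by rewrite -ler_expR lnK.
have se : e^-1 <= Num.sqrt (ln n%:R).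
  rewrite -[leLHS](@ger0_norm R) ?invr_ge0 ?(ltW e0) // -sqrtr_sqr.
  exact: ler_wsqrtr.
rewrite sub0r normrN ger0_norm ?expR_ge0 // expRN -[leRHS]invrK.
rewrite lef_pV2 ?posrE ?invr_gt0 ?expR_gt0 //; apply: (le_trans se).
by apply: le_trans (expR_ge1Dx _); rewrite lerDr.
Unshelve. all: by end_near.
Qed.

Lemma mean_cvg (a : nat -> R) (c K : R) : 0 <= K ->
  (\forall n \near \oo, `|a n - c * n%:R| <= K * error_term (2^-1) n) ->
  a n / n%:R @[n --> \oo] --> c.
Proof.
move=> K0 /(mean_rate K0) h; apply/cvgrPdist_le => e e0.
have h0 : K * expR (- Num.sqrt (ln (n%:R : R))) @[n --> \oo] --> K * 0.
  by apply: cvgM; [exact: cvg_cst | exact: expR_sqrt_ln_cvg0].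
rewrite mulr0 in h0; move/cvgrPdist_le: h0 => /(_ e e0) h0.
near=> n; rewrite distrC.
have h1 : `|a n / n%:R - c| <= K * expR (- Num.sqrt (ln n%:R)) by near: n.
apply: (le_trans h1).
have : `|0 - K * expR (- Num.sqrt (ln n%:R))| <= e by near: n.
by rewrite sub0r normrN ger0_norm // mulr_ge0 ?expR_ge0.
Unshelve. all: by end_near.
Qed.

Lemma expR_lipschitz (x y : R) :
  `|expR x - expR y| <= (expR x + expR y) * `|x - y|.
Proof.
wlog xy : x y / y <= x.
  move=> h; have [|/ltW] := leP y x; first exact: h.
  by move=> /h; rewrite distrC (distrC y) (addrC (expR y)).
rewrite !ger0_norm ?subr_ge0 ?ler_expR //.
have h : expR x * (1 + (y - x)) <= expR y.
  have -> : expR y = expR x * expR (y - x) by rewrite -expRD addrC subrK.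
  by rewrite ler_wpM2l ?expR_ge0 ?expR_ge1Dx.
have : 0 <= expR y * (x - y) by rewrite mulr_ge0 ?expR_ge0 ?subr_ge0.
by lra.
Qed.

(** A shift of the index by the fixed number k0 + m + 1, where K <= 2 ^ (m + 1), absorbs both K and
    k0. The shifted sequences are recursive whatever these numbers are. *)
Lemma computable_of_approx (x K : R) (a b : nat -> nat) (k0 : nat) :
  recursive1 a -> recursive1 b -> (forall k, b k <> 0%N) ->
  (forall k, (k0 <= k)%N -> `|x - (a k)%:R / (b k)%:R| <= K * 2 ^- k) ->
  computable_real x.
Proof.
move=> ha hb b0 h.
pose m := Num.truncn `|K|; pose k1 := (k0 + m)%N.
have Km : K <= 2 ^+ m.+1.
  apply: (le_trans (ler_norm K)).
  have /andP[_ /ltW h1] := truncn_itv (normr_ge0 K); apply: (le_trans h1).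
  by rewrite -natrX ler_nat ltnW // ltn_expl.
have hs (u : nat -> nat) : recursive1 u -> recursive1 (fun k => u (k + k1.+1)%N).
  move=> hu; apply: (@recursive_comp1 1 u (fun v => thead v + k1.+1)%N hu).
  apply: (recursive_comp2 recursive2_addn); [exact: recursive_head|exact: recursive_const].
exists (fun=> 0%N), (fun k => a (k + k1.+1)%N), (fun k => b (k + k1.+1)%N); split.
- exact: recursive1_const.
- exact: hs.
- exact: hs.
- by [].
move=> k; rewrite expr0 mul1r.
apply: (le_trans (h _ _)); first by rewrite /k1; lia.
have -> : (k + k1.+1 = m.+1 + (k0 + k))%N by rewrite /k1; lia.
rewrite exprD invfM mulrA.
apply: (@le_trans _ _ (1 * (2 ^+ (k0 + k))^-1)).
  rewrite ler_wpM2r ?invr_ge0 ?exprn_ge0 // ler_pdivrMr ?exprn_gt0 // mul1r //.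
rewrite mul1r lef_pV2 ?posrE ?exprn_gt0 // ler_weXn2l ?ler1n //.
by rewrite leq_addl.
Qed.

Lemma near_fast (Q : nat -> Prop) : (\forall n \near \oo, Q n) ->
  exists k0, forall k, (k0 <= k)%N -> Q (2 ^ (k * k))%N.
Proof.
move=> [n0 _ h]; exists n0 => k hk; apply: h => /=.
apply: (leq_trans hk); apply: leq_trans (ltnW (ltn_expl _ (ltnSn 1))).
by case: k {hk} => // k; rewrite leq_pmulr.
Qed.

(** sqrt (k ^ 2 ln 2) >= k ln 2 since ln 2 <= 1; this dictates the subsequence 2 ^ (k ^ 2). *)
Lemma fast_rate k : expR (- Num.sqrt (ln ((2 ^ (k * k))%:R : R))) <= 2 ^- k.
Proof.
have /andP[l1 l2] := ln2_bounds R; have l0 : 0 <= ln 2 :> R by lra.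
rewrite expRN lef_pV2 ?posrE ?expR_gt0 ?exprn_gt0 //.
have -> : 2 ^+ k = expR (k%:R * ln 2) :> R by rewrite expRM_natl lnK ?posrE.
rewrite ler_expR -[leLHS](@ger0_norm R) ?mulr_ge0 // -sqrtr_sqr ler_wsqrtr //.
rewrite natrX lnXn // -[_ *+ (k * k)]mulr_natl natrM exprMn -expr2 ler_wpM2l ?exprn_ge0 //.
by rewrite expr2 ler_piMl.
Qed.

Lemma fast_approx (a : nat -> R) (c K : R) : 0 <= K ->
  (\forall n \near \oo, `|a n - c * n%:R| <= K * error_term (2^-1) n) ->
  exists k0, forall k, (k0 <= k)%N ->
    `|a (2 ^ (k * k))%N / (2 ^ (k * k))%:R - c| <= K * 2 ^- k.
Proof.
move=> K0 /(mean_rate K0) /near_fast [k0 h]; exists k0 => k /h hk.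
by apply: (le_trans hk); rewrite ler_wpM2l // fast_rate.
Qed.

Lemma recursive_fast : recursive1 (fun k => 2 ^ (k * k))%N.
Proof.
apply: recursive_exp2; apply: (recursive_comp2 recursive2_muln); exact: recursive_head.
Qed.

Lemma q_le (P : set {fset nat}) n : (q_ P n <= 2 ^ n)%N.
Proof.
apply: (@leq_trans #|` fpowerset (nat_interval 1 n)|).
  apply: fsubset_leq_card; apply/fsubsetP => B.
  by rewrite !inE => /andP[].
by rewrite card_fpowerset leq_exp2l // card_nat_interval.
Qed.

(* floor (2 ^ k * q ^ (1 / n)) whenever q <= 2 ^ n. *)
Definition root_floor (q n k : nat) : nat :=
  (\sum_(0 <= j < 2 ^ k.+1) (j.+1 ^ n <= q * 2 ^ (k * n)))%N.

(** The test is j + 1 <= 2 ^ k q ^ (1 / n), raised to the n-th power. The range 2 ^ (k + 1) suffices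
    because q <= 2 ^ n gives q ^ (1 / n) <= 2. *)
Lemma root_floorP (q n k : nat) : (0 < n)%N -> (0 < q <= 2 ^ n)%N ->
  `|expR (ln (q%:R : R) / n%:R) - (root_floor q n k)%:R / (2 ^ k)%:R| <= 2 ^- k.
Proof.
move=> n0 /andP[q0 qn]; set rho := expR _.
have nR : n%:R != 0 :> R by rewrite pnatr_eq0 -lt0n.
have qR : 0 < q%:R :> R by rewrite ltr0n.
have rn : rho ^+ n = q%:R.
  by rewrite /rho -expRM_natl mulrCA divff // mulr1 lnK.
have rho0 : 0 <= rho by apply: expR_ge0.
have p0 : 0 < (2 ^ k)%:R :> R by rewrite ltr0n expn_gt0.
have x0 : 0 <= (2 ^ k)%:R * rho by rewrite mulr_ge0 // ltW.
have rho2 : rho <= 2.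
  by rewrite -(@ler_pXn2r _ n) ?nnegrE // rn -natrX ler_nat.
have -> : root_floor q n k = Num.truncn ((2 ^ k)%:R * rho).
  rewrite -(@count_prefix (2 ^ k.+1) (Num.truncn _)); last first.
    rewrite -(ler_nat R) (le_trans (_ : _ <= (2 ^ k)%:R * rho)) ?truncn_le //.
    by rewrite expnS natrM mulrC ler_wpM2r // ltW.
  apply: eq_bigr => j _; congr nat_of_bool.
  rewrite truncn_gt_nat -(@ler_pXn2r _ n) ?nnegrE // exprMn rn.
  by rewrite -natrX -natrX -natrM ler_nat -expnM mulnC.
have /andP[t1 t2] := truncn_itv x0; rewrite -natr1 in t2.
set X : R := (Num.truncn _)%:R in t1 t2 *.
have -> : rho - X / (2 ^ k)%:R = ((2 ^ k)%:R * rho - X) / (2 ^ k)%:R.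
  by field; rewrite gt_eqF.
rewrite normrM normfV [ `|(2 ^ k)%:R| ]gtr0_norm // -natrX.
rewrite -[leRHS]mul1r ler_wpM2r ?invr_ge0 ?(ltW p0) //.
by rewrite ler_norml; apply/andP; split; lra.
Qed.

End Rates.

Lemma recursive_root_floor (P : set {fset nat}) : recursive1 (q_ P) ->
  recursive1 (fun k => root_floor (q_ P (2 ^ (k * k))) (2 ^ (k * k)) k).
Proof.
move=> hq.
apply: (recursive_sum (F := fun j (v : 1.-tuple nat) => let k := thead v in
  (j.+1 ^ 2 ^ (k * k) <= q_ P (2 ^ (k * k)) * 2 ^ (k * 2 ^ (k * k)) : nat)%N)).
  exact/recursive_exp2/(recursive_comp1 recursive1_succ)/recursive_head.
have hk := recursive_weaken (recursive_head 0).
have hn := recursive_comp1 recursive_fast hk.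
apply: (recursive_comp2 recursive2_leq).
  apply: (recursive_comp2 recursive2_expn) hn.
  exact: recursive_comp1 recursive1_succ (recursive_head _).
apply: (recursive_comp2 recursive2_muln); first exact: recursive_comp1 hq hn.
exact/recursive_exp2/(recursive_comp2 recursive2_muln hk hn).
Qed.

(** * Asymptotics of f and q, and computability of the constants *)

Local Open Scope classical_set_scope.
Local Open Scope ring_scope.

Theorem theorem2p1 (R : realType) (P : set {fset nat})
    (P_pos : on_positive P)
    (P_empty : P fset0)
    (P_down : downward_closed P)
    (P_decomp : decomposes P)
    (P_dil : dilation_invariant P) :
  [/\ C_abs_cvg (@PhiR R P) /\ C_abs_cvg (@logQ R P),
      forall eps : R, 0 < eps ->
        exists K : R, \forall n \near \oo,
          `|(f_ P n)%:R - c_ R P * n%:R| <= K * error_term eps n,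
      forall eps : R, 0 < eps ->
        exists K : R, \forall n \near \oo,
          `|ln (q_ P n)%:R - n%:R * ln (beta_ R P)| <= K * error_term eps n,
      ((q_ P n)%:R : R) `^ (n%:R)^-1 @[n --> \oo] --> beta_ R P &
      decidable_family P ->
        computable_real (c_ R P) /\ computable_real (beta_ R P)].
Proof.
have aPhi := divisor_additive_Phi R P_empty P_down P_decomp P_dil.
have aQ := divisor_additive_logQ R P_empty P_down P_decomp P_dil.
have lnb : ln (beta_ R P) = C_ (@logQ R P) by rewrite /beta_ expRK.
have q0 n : (0 < q_ P n)%N by apply: Q_gt0.
(* The exponent eps = 1/2 is enough for the limit and for computability. *)
have half0 : 0 < 2^-1 :> R by rewrite invr_gt0.
have [Kf [Kf0 hf]] := Psi_asymptotics aPhi half0.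
have [Kq [Kq0 hq]] := Psi_asymptotics aQ half0.
split.
- by split; apply: C_abs_cvg_gain.
- by move=> eps /(Psi_asymptotics aPhi)[K [_ h]]; exists K.
- move=> eps /(Psi_asymptotics aQ)[K [_ h]]; exists K.
  by rewrite lnb; near=> n; rewrite (mulrC n%:R); near: n; apply: h.
- have h : expR (ln ((q_ P n)%:R : R) / n%:R) @[n --> \oo] --> beta_ R P.
    exact: (cvg_comp _ _ (mean_cvg Kq0 hq) (@continuous_expR R _)).
  apply: cvg_trans h; apply: near_eq_cvg; near=> n.
  by rewrite /powR pnatr_eq0 (gtn_eqF (q0 n)) mulrC.
move=> [chi [chi_rec chiP]]; split.
  have [k0 h] := fast_approx Kf0 hf.
  apply: (@computable_of_approx R _ Kf (fun k => f_ P (2 ^ (k * k)))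
    (fun k => 2 ^ (k * k))%N k0).
  - exact: recursive_comp1 (recursive_f chiP chi_rec) (recursive_fast).
  - exact: recursive_fast.
  - by move=> k; apply/eqP; rewrite -lt0n expn_gt0.
  by move=> k /h; rewrite distrC.
have [k0 h] := fast_approx Kq0 hq.
(* With y = ln q / n <= 1, M bounds exp y + beta, the Lipschitz factor between ln beta and beta; the
   further 1 in M Kq + 1 is the rounding error of [root_floor]. *)
pose M := expR 1 + beta_ R P.
apply: (@computable_of_approx R _ (M * Kq + 1)
  (fun k => root_floor (q_ P (2 ^ (k * k))) (2 ^ (k * k)) k) (fun k => 2 ^ k)%N k0).
- exact/recursive_root_floor/(recursive_q chiP chi_rec).
- exact/recursive_exp2/recursive_head.
- by move=> k; apply/eqP; rewrite -lt0n expn_gt0.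
move=> k /h; set n := (2 ^ (k * k))%N => hk.
have n0 : (0 < n)%N by rewrite expn_gt0.
have nR : 0 < n%:R :> R by rewrite ltr0n.
have qn : (0 < q_ P n <= 2 ^ n)%N by rewrite q0 q_le.
have h1 := @root_floorP R (q_ P n) n k n0 qn.
set A := (root_floor _ _ _)%:R / _ in h1 *; set y := ln _ / _ in h1 hk.
have y1 : y <= 1.
  rewrite ler_pdivrMr // mul1r.
  apply: (@le_trans _ _ (ln (2 ^ n)%:R)).
    by rewrite ler_ln ?posrE ?ltr0n ?expn_gt0 ?q0 // ler_nat q_le.
  have /andP[_ l2] := ln2_bounds R.
  by rewrite natrX lnXn // -[_ *+ n]mulr_natl ler_piMr // ltW.
rewrite -(subrK (expR y) (beta_ R P)) -addrA; apply: (le_trans (ler_normD _ _)).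
rewrite mulrDl mul1r; apply: lerD => //.
rewrite distrC; apply: (le_trans (expR_lipschitz _ _)).
rewrite -mulrA; apply: ler_pM => //.
by rewrite /M /beta_ lerD2r ler_expR.
Unshelve. all: by end_near.
Qed.
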